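(* Fix a dimension $d\ge2$. There is a constant $C_d$ depending only on $d$ such that the following holds. Let $n,n_0,p$ be positive integers with $p\le n_0\le 2p$, and put $N_0=n_0^d$ and $N=n^d$. Let $I=[n]^d$ be the index set of the uniform tensor grid on $[0,1]^d$ with $n$ points in each direction, let $T_I$ be the tensor node cluster tree constructed by recursive $2^d$ uniform partition, each of whose leaf nodes contains at most $N_0$ points, and let $T_{I\times I}$ be the corresponding tensor node block cluster tree under either the weak admissibility condition or the strong admissibility condition with $\eta=\sqrt d$. Let $\boldsymbol{A}^{\mathrm{HTLR}}$ be an HTLR matrix on $T_{I\times I}$ of rank $p$. Then, for every vector $\boldsymbol{u}\in\mathbb{R}^N$, the HTLR matrix-vector multiplication algorithm computes $\boldsymbol{A}^{\mathrm{HTLR}}\boldsymbol{u}$ using at most $C_d\,(pN\log N+p^dN)$ arithmetic operations, i.e. its complexity is $O(pN\log N+p^dN)$.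
   Context: Notation: $[n]=\{1,\dots,n\}$, $h=1/n$. Grid: the grid point with multi-index $\boldsymbol{i}=(i_1,\dots,i_d)\in[n]^d$ is $\boldsymbol{x}_{\boldsymbol{i}}=((i_1-\tfrac12)h,\dots,(i_d-\tfrac12)h)$, with computational domain $\Omega_{\boldsymbol{i}}=\prod_\ell[(i_\ell-1)h,i_\ell h]$. For $\tau\subset I$, $\Omega_\tau=\bigcup_{\boldsymbol{i}\in\tau}\Omega_{\boldsymbol{i}}$. Cluster tree: a tree $T_I$ whose nodes are nonempty subsets of $I$, with root $I$, such that each node either has no children (a leaf) or is the disjoint union of its children. It is a tensor node cluster tree if every node has the form $\tau=\tau_1\times\dots\times\tau_d$, with $\tau_\ell$ an index set for the $\ell$-th dimension. Recursive $2^d$ uniform partition: a node $\tau$ with $|\tau|\le N_0$ is a leaf and is not partitioned further; a node with $|\tau|>N_0$ is split into (up to) $2^d$ children by splitting each index interval $\tau_\ell$ into two consecutive intervals of sizes as equal as possible (empty children are discarded). Weak admissibility: two nodes $\tau,\sigma$ are admissible if $\Omega_\tau\cap\Omega_\sigma$ has measure zero. Strong admissibility with parameter $\eta>0$: $\tau,\sigma$ are admissible if $\max\{\operatorname{diam}(\Omega_\tau),\operatorname{diam}(\Omega_\sigma)\}\le\eta\operatorname{dist}(\Omega_\tau,\Omega_\sigma)$ (Euclidean diameter and distance). Block cluster tree $T_{I\times I}$: built from the root $(I,I)$ as follows. If $\tau,\sigma$ are admissible, $(\tau,\sigma)$ is an admissible leaf; otherwise, if $\tau$ or $\sigma$ is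 a leaf of $T_I$, $(\tau,\sigma)$ is an inadmissible leaf; otherwise $(\tau,\sigma)$ is a non-leaf node with children all $(\tau',\sigma')\in\operatorname{children}(\tau)\times\operatorname{children}(\sigma)$. It is called a tensor node block cluster tree when $T_I$ is a tensor node cluster tree. HTLR (hierarchical Tucker low-rank) matrix of rank $p$ on $T_{I\times I}$: a matrix $\boldsymbol{A}^{\mathrm{HTLR}}\in\mathbb{R}^{I\times I}$ stored as follows. For an admissible leaf $(\tau,\sigma)$, the block $\boldsymbol{A}^{\mathrm{HTLR}}_{\tau,\sigma}$, viewed as a $2d$-order tensor, is given in Tucker form $\boldsymbol{\mathcal{G}}\times_1\boldsymbol{U}_1\times_2\cdots\times_d\boldsymbol{U}_d\times_{d+1}\boldsymbol{V}_1\times_{d+2}\cdots\times_{2d}\boldsymbol{V}_d$ with $\boldsymbol{U}_\ell\in\mathbb{R}^{|\tau_\ell|\times p}$, $\boldsymbol{V}_\ell\in\mathbb{R}^{|\sigma_\ell|\times p}$, $\boldsymbol{\mathcal{G}}\in\mathbb{R}^{p\times\dots\times p}$ ($2d$ modes), where $\times_\ell$ is the mode-$\ell$ product. For an inadmissible leaf, the block is a dense matrix. For a non-leaf node, the block is the block matrix made of the blocks of its children. HTLR matrix-vector multiplication algorithm: initialize $\boldsymbol{f}=0$ and, starting from $(\tau,\sigma)=(I,I)$, perform the update $\boldsymbol{f}_\tau\leftarrow\boldsymbol{f}_\tau+\boldsymbol{A}^{\mathrm{HTLR}}_{\tau,\sigma}\boldsymbol{u}_\sigma$ recursively. (i) If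 $(\tau,\sigma)$ is an admissible leaf, reshape $\boldsymbol{u}_\sigma$ into a $d$-order tensor $\boldsymbol{\mathcal{U}}_\sigma$; compute $\boldsymbol{\mathcal{W}}_\sigma=\boldsymbol{\mathcal{U}}_\sigma\times_1\boldsymbol{V}_1^{*}\times_2\cdots\times_d\boldsymbol{V}_d^{*}$ mode by mode ($*$ denotes the conjugate transpose); contract the last $d$ modes of $\boldsymbol{\mathcal{G}}$ with the $d$ modes of $\boldsymbol{\mathcal{W}}_\sigma$ to obtain $\boldsymbol{\mathcal{H}}_\tau$; compute $\boldsymbol{\mathcal{F}}_\tau=\boldsymbol{\mathcal{H}}_\tau\times_1\boldsymbol{U}_1\times_2\cdots\times_d\boldsymbol{U}_d$ mode by mode; reshape $\boldsymbol{\mathcal{F}}_\tau$ into a vector and add it to $\boldsymbol{f}_\tau$. (ii) If $(\tau,\sigma)$ is an inadmissible leaf, apply the dense block directly. (iii) If $(\tau,\sigma)$ is a non-leaf node, recurse on each child $(\tau',\sigma')$. All individual contractions and dense products are carried out by the standard (naive) algorithms. Complexity is the number of arithmetic operations. *)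

(* Defs.v *)
From HB Require Import structures.
From mathcomp Require Import all_boot all_order all_algebra.

Set Implicit Arguments.
Unset Strict Implicit.
Unset Printing Implicit Defensive.

Import Order.TTheory GRing.Theory Num.Theory.

Section Clusters.
Variables d n : nat.

(* Multi-indices are 0-based: [i l : 'I_n] stands for i_l - 1. *)
Definition grid : finType := {ffun 'I_d -> 'I_n}.

(* A tensor node tau_1 x ... x tau_d is stored through its factors tau_l;
   [points] is the node as a subset of the grid. *)
Definition node : finType := {ffun 'I_d -> {set 'I_n}}.

Definition points (tau : node) : {set grid} :=
  [set i : grid | [forall l, i l \in tau l]].

Definition full_node : node := [ffun _ => [set: 'I_n]].

Inductive ctree : Type :=
  CNode (tau : node) (k : nat) (c : 'I_k -> ctree).

Definition croot (t : ctree) : node := let: CNode tau _ _ := t in tau.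
Definition arity (t : ctree) : nat := let: CNode _ k _ := t in k.
Definition child (t : ctree) : 'I_(arity t) -> ctree :=
  match t return 'I_(arity t) -> ctree with CNode _ _ c => c end.
Arguments child : clear implicits.
Definition is_leaf (t : ctree) : bool := arity t == 0.

Fixpoint cluster_subtree (t : ctree) : Prop :=
  let: CNode tau k c := t in
  [/\ points tau != set0,
      k = 0 \/
        points tau = \bigcup_(i < k) points (croot (c i)) /\
        (forall i j, i != j ->
           [disjoint points (croot (c i)) & points (croot (c j))])
    & forall i, cluster_subtree (c i)].

Definition tensor_cluster_tree (t : ctree) : Prop :=
  croot t = full_node /\ cluster_subtree t.

(* [S] is cut into consecutive parts [S1] < [S2] whose sizes differ by at most
   one.  Which part gets the extra point of an interval of odd size is left
   free. *)
Definition halves (S S1 S2 : {set 'I_n}) : Prop :=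
  [/\ S = S1 :|: S2, {in S1 & S2, forall x y : 'I_n, x < y},
      #|S1| <= #|S2|.+1 & #|S2| <= #|S1|.+1].

Definition subbox (lo hi : node) (b : {ffun 'I_d -> bool}) : node :=
  [ffun l => if b l then hi l else lo l].

Fixpoint uniform_partition (N0 : nat) (t : ctree) : Prop :=
  let: CNode tau k c := t in
  (if #|points tau| <= N0 then k = 0
   else exists lo hi : node,
     (forall l, halves (tau l) (lo l) (hi l)) /\
     perm_eq [seq croot (c i) | i : 'I_k]
             [seq s <- [seq subbox lo hi b | b : {ffun 'I_d -> bool}]
                | points s != set0]) /\
  (forall i, uniform_partition N0 (c i)).

End Clusters.

Arguments full_node {d n}.
Arguments child {d n} t.

Section BlockClusterTree.
Variables (d n : nat) (adm : node d n -> node d n -> Prop).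

(* [block_tree t s] is the type of block cluster trees with root (t, s).  The
   three constructors are mutually exclusive and exhaustive, so that, up to
   the proofs they carry, each pair (t, s) has exactly one block cluster
   tree. *)
Inductive block_tree : ctree d n -> ctree d n -> Type :=
| AdmLeaf t s of adm (croot t) (croot s) : block_tree t s
| InadmLeaf t s of ~ adm (croot t) (croot s) & is_leaf t || is_leaf s :
    block_tree t s
| NonLeaf t s of ~ adm (croot t) (croot s) & ~~ (is_leaf t || is_leaf s) &
    (forall i j, block_tree (child t i) (child s j)) : block_tree t s.

End BlockClusterTree.

Local Open Scope ring_scope.

Section Tensors.
Variables (R : pzRingType) (L : finType).

(* Tensors whose modes are labelled by [L] (order #|L|), the mode [l] having
   size [m l]. *)
Definition index (m : L -> nat) : finType := {dffun forall l : L, 'I_(m l)}.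
Definition tensor (m : L -> nat) : Type := {ffun index m -> R}.

(* Entries are read at plain natural multi-indices (0 out of bounds), which
   avoids transporting indices between shapes that are only pointwise equal. *)
Definition entry m (T : tensor m) (i : L -> nat) : R :=
  if [pick x : index m | [forall l, x l == i l :> nat]] is Some x
  then T x else 0.

Definition set_mode (v : L -> nat) (l : L) (k : nat) : L -> nat :=
  fun l' => if l' == l then k else v l'.

Lemma set_modeE v l k : set_mode v l k l = k.
Proof. by rewrite /set_mode eqxx. Qed.

Definition coord m l k (i : index (set_mode m l k)) : 'I_k :=
  cast_ord (set_modeE m l k) (i l).

Definition mode_prod m (l : L) k q (M : 'M[R]_(k, q)) (T : tensor m) :
    tensor (set_mode m l k) :=
  [ffun i => \sum_(j < q)
     M (coord i) j * entry T (set_mode (fun l' => i l') l j)].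

Section Iterated.
Variables (m m' : L -> nat) (M : forall l, 'M[R]_(m' l, m l)).

Fixpoint final_shape (ls : seq L) (s : L -> nat) : L -> nat :=
  if ls is l :: ls' then final_shape ls' (set_mode s l (m' l)) else s.

Fixpoint mode_prods_seq (ls : seq L) (s : L -> nat) (T : tensor s) :
    tensor (final_shape ls s) :=
  match ls return tensor (final_shape ls s) with
  | [::] => T
  | l :: ls' => mode_prods_seq ls' (mode_prod l (M l) T)
  end.

Definition mode_prods (T : tensor m) : tensor (final_shape (enum L) m) :=
  mode_prods_seq (enum L) T.

End Iterated.
End Tensors.

Section Storage.
Variables (R : realFieldType) (d n p : nat).

(* The first d modes of the core are labelled by [inl], the last d by [inr]. *)
Definition core : Type := tensor R (fun _ : 'I_d + 'I_d => p).

Record tucker (tau sigma : node d n) := Tucker {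
  tcore : core;
  tU : forall l, 'M[R]_(#|tau l|, p);
  tV : forall l, 'M[R]_(#|sigma l|, p) }.

Definition tucker_tensor tau sigma (B : tucker tau sigma) :=
  mode_prods
    (m' := fun l => match l with inl a => #|tau a| | inr b => #|sigma b| end)
    (fun l => match l with inl a => tU B a | inr b => tV B b end)
    (tcore B).

Definition dense (tau sigma : node d n) : Type :=
  {ffun {x | x \in points tau} -> {ffun {y | y \in points sigma} -> R}}.

(* Position of a grid point of [tau] inside [tau], mode by mode: this is the
   reshaping of a vector on [tau] into a d-order tensor. *)
Definition rank (tau : node d n) (x : grid d n) (l : 'I_d) : nat :=
  seq.index (x l) (enum (tau l)).

Variable adm : node d n -> node d n -> Prop.

Fixpoint htlr_storage t s (B : block_tree adm t s) : Type :=
  match B with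
  | AdmLeaf t s _ => tucker (croot t) (croot s)
  | InadmLeaf t s _ _ => dense (croot t) (croot s)
  | NonLeaf t s _ _ F => forall i j, htlr_storage (F i j)
  end.

(* [A] is the I x I matrix stored by [S]; a non-leaf block is constrained
   through its children, whose products partition t x s. *)
Fixpoint represents (A : grid d n -> grid d n -> R) t s
    (B : block_tree adm t s) : htlr_storage B -> Prop :=
  match B return htlr_storage B -> Prop with
  | AdmLeaf t s _ => fun S =>
      forall x y, x \in points (croot t) -> y \in points (croot s) ->
      A x y = entry (tucker_tensor S)
                (fun l => match l with
                          | inl a => rank (croot t) x a
                          | inr b => rank (croot s) y b
                          end)
  | InadmLeaf t s _ _ => fun S => forall x y, A (val x) (val y) = S x y
  | NonLeaf t s _ _ F => fun S => forall i j, represents A (S i j)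
  end.

End Storage.

(* A computation is its result together with the number of arithmetic
   operations it performs; only [cadd] and [cmul] have a cost. *)
Definition counted (X : Type) : Type := (X * nat)%type.
Definition cret X (x : X) : counted X := (x, 0%N).
Definition cbind X Y (a : counted X) (f : X -> counted Y) : counted Y :=
  ((f a.1).1, (a.2 + (f a.1).2)%N).

Notation "'let!' x ':=' a 'in' b" := (cbind a (fun x => b))
  (at level 200, x name, a at level 100, b at level 200).

Definition ctab (X : finType) Y (F : X -> counted Y) : counted {ffun X -> Y} :=
  ([ffun x => (F x).1], (\sum_x (F x).2)%N).

Section Algorithm.
Variables (R : realFieldType).

Definition cadd (x y : R) : counted R := (x + y, 1%N).
Definition cmul (x y : R) : counted R := (x * y, 1%N).

(* Naive accumulation from 0 of \sum_j a_j * b_j: 2 #|J| operations. *)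
Definition cdot (J : finType) (a b : J -> R) : counted R :=
  foldl (fun acc j => let! s := acc in let! t := cmul (a j) (b j) in cadd s t)
    (cret 0) (enum J).

Section ModeProducts.
Variable (L : finType).

Definition cmode_prod m (l : L) k q (M : 'M[R]_(k, q)) (T : tensor R m) :
    counted (tensor R (set_mode m l k)) :=
  ctab (fun i : index (set_mode m l k) =>
    cdot (fun j : 'I_q => M (coord i) j)
         (fun j : 'I_q => entry T (set_mode (fun l' => i l') l j))).

Variables (m m' : L -> nat) (M : forall l, 'M[R]_(m' l, m l)).

Fixpoint cmode_prods_seq (ls : seq L) (s : L -> nat) (T : tensor R s) :
    counted (tensor R (final_shape m' ls s)) :=
  match ls return counted (tensor R (final_shape m' ls s)) with
  | [::] => cret T
  | l :: ls' => let! T' := cmode_prod l (M l) T in cmode_prods_seq ls' T'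
  end.

Definition cmode_prods (T : tensor R m) :
    counted (tensor R (final_shape m' (enum L) m)) :=
  cmode_prods_seq (enum L) T.

End ModeProducts.

Variables (d n p : nat).

Local Notation vector := {ffun grid d n -> R}.

Definition reshape (sigma : node d n) (u : vector) :
    tensor R (fun l => #|sigma l|) :=
  [ffun i : index (fun l => #|sigma l|) => u [ffun l => enum_val (i l)]].

Definition ccontract m (G : core R d p) (W : tensor R m) :
    counted (tensor R (fun _ : 'I_d => p)) :=
  ctab (fun a : index (fun _ : 'I_d => p) =>
    cdot (fun b : index (fun _ : 'I_d => p) =>
            entry G (fun l => match l with
                              | inl q => a q : nat
                              | inr q => b q : nat
                              end))
         (fun b : index (fun _ : 'I_d => p) => entry W (fun q => b q))).

(* f_tau <- f_tau + g, leaving the entries of f outside tau unchanged. *)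
Definition cupdate (tau : node d n) (f : vector)
    (g : {x | x \in points tau} -> counted R) : counted vector :=
  let! v := ctab (fun x => let! y := g x in cadd (f (val x)) y) in
  cret [ffun x => if insub x is Some x' then v x' else f x].

Definition admissible_update (tau sigma : node d n) (B : tucker R p tau sigma)
    (u f : vector) : counted vector :=
  (* the data are real, so the conjugate transpose is the transpose *)
  let! W := cmode_prods (fun l => (tV B l)^T) (reshape sigma u) in
  let! H := ccontract (tcore B) W in
  let! F := cmode_prods (tU B) H in
  cupdate f (fun x : {x | x \in points tau} =>
    cret (entry F (rank tau (val x)))).

Definition dense_update (tau sigma : node d n) (D : dense R tau sigma)
    (u f : vector) : counted vector :=
  cupdate f (fun x : {x | x \in points tau} =>
    cdot (D x) (fun y : {y | y \in points sigma} => u (val y))).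

Variable adm : node d n -> node d n -> Prop.

Fixpoint htlr_update (u : vector) t s (B : block_tree adm t s) :
    htlr_storage R p B -> vector -> counted vector :=
  match B return htlr_storage R p B -> vector -> counted vector with
  | AdmLeaf t s _ => fun S f => admissible_update S u f
  | InadmLeaf t s _ _ => fun S f => dense_update S u f
  | NonLeaf t s _ _ F => fun S f =>
      foldl (fun acc ij => let! g := acc in htlr_update u (S ij.1 ij.2) g)
        (cret f) (enum {: 'I_(arity t) * 'I_(arity s)})
  end.

Definition htlr_matvec t s (B : block_tree adm t s) (S : htlr_storage R p B)
    (u : vector) : counted vector :=
  htlr_update u S [ffun _ => 0].

End Algorithm.

From mathcomp Require Import all_classical all_reals all_analysis.

Local Open Scope classical_set_scope.

Section Admissibility.
Variables (R : realType) (d n : nat).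

Definition cell (i : grid d n) : set 'rV[R]_d :=
  [set x | forall l, (i l)%:R / n%:R <= x 0 l <= (i l).+1%:R / n%:R].

Definition domain (tau : node d n) : set 'rV[R]_d :=
  \bigcup_(i in [set i | i \in points tau]) cell i.

(* Lebesgue-null sets of R^d: for every e > 0 there is a countable cover by
   boxes of total volume at most e. *)
Definition measure_zero (E : set 'rV[R]_d) : Prop :=
  forall e : R, 0 < e -> exists a b : nat -> 'rV[R]_d,
    [/\ forall k l, a k 0 l <= b k 0 l,
        E `<=` \bigcup_k [set x | forall l, a k 0 l <= x 0 l <= b k 0 l]
      & (\sum_(0 <= k <oo) (\prod_(l < d) (b k 0 l - a k 0 l))%:E <= e%:E)%E].

(* The norm of the library on 'rV[R]_d is the maximum norm. *)
Definition euclid (x y : 'rV[R]_d) : R :=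
  Num.sqrt (\sum_(l < d) (x 0 l - y 0 l) ^+ 2).

Definition diam (E : set 'rV[R]_d) : R :=
  sup [set euclid xy.1 xy.2 | xy in E `*` E].

Definition dist (E F : set 'rV[R]_d) : R :=
  inf [set euclid xy.1 xy.2 | xy in E `*` F].

Definition weakly_admissible (tau sigma : node d n) : Prop :=
  measure_zero (domain tau `&` domain sigma).

Definition strongly_admissible (eta : R) (tau sigma : node d n) : Prop :=
  Num.max (diam (domain tau)) (diam (domain sigma))
    <= eta * dist (domain tau) (domain sigma).

End Admissibility.

(* Main.v *)
Require Import Defs.
From mathcomp Require Import all_boot all_order all_algebra.
From mathcomp Require Import all_classical all_reals all_analysis.
From mathcomp Require Import measurable_realfun.
From mathcomp Require Import zify ring lra.

Import Order.TTheory GRing.Theory Num.Theory.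
Local Open Scope ring_scope.

Set Implicit Arguments.
Unset Strict Implicit.
Unset Printing Implicit Defensive.

(** The cost.  Halving an interval keeps all interval lengths of one level of
the cluster tree within one of each other: at level k they are [side n k] =
floor (n / 2^k) or one more.  A node that is split has more than n0^d points,
so its level satisfies n0 <= side n k; hence only about log2 (n / n0) levels
contain split nodes.  Two nodes of the same level are admissible, for either
condition, as soon as two of their points are 6 side apart in some coordinate:
the domains are then at distance at least 2 side / n, which makes them disjoint
and is at least diam / sqrt d.  So every branch (tau, sigma) of the block tree at
level k consists of pairs of points of tau x sigma that are close to each
other.

Each leaf below a branch of level k costs at most [leaf_cost k] =
O(p side^d + p^(2d)) operations, and a branch has at most 4^d children.  The
work is distributed over pairs of grid points: a branch of level k covers at
least side^(2d) close pairs, so charging [weight k] = 4^d leaf_cost k /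
side^(2d) to each of them pays for its leaf children.  The resulting
[potential] is additive over the products of children
([potential_children]), which turns the recursion of the algorithm into the
induction [branch_update_cost].  At the root there are at most N (12 side)^d
close pairs of level k, hence a total of O(N (p + p^(2d) / side^d)) per level
([potential_full]).  Summed over the levels, the first term gives p N log N;
the second one is a geometric series dominated by the deepest level, where
side >= n0 >= p, and gives p^d N.

If the root is not split, then n <= n0 <= 2 p and a dense product costs
O(N n0^d).  This uses that the root is not an admissible pair: the diameter of
the cube is positive ([full_not_strongly_admissible]) and the cube is not
covered by boxes of small total volume ([full_not_weakly_admissible]).

The result.  Mode products over distinct modes compose to a Kronecker product
([entry_mode_prods]); with it the three contractions of an admissible update
multiply out to the product of the Tucker block with the vector
([admissible_updateE]), and the blocks of a branch add up because the children
of a cluster partition it ([htlr_updateE]). *)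

(** * Entries of mode products *)

Section TensorEntries.
Variables (R : comNzRingType) (L : finType).
Implicit Types m s : L -> nat.

Lemma eq_entry m (T : tensor R m) i i' : i =1 i' -> entry T i = entry T i'.
Proof.
move=> eq_i; rewrite /entry; congr (if _ is Some x then _ else _).
by apply: eq_pick => x /=; apply: eq_forallb => l; rewrite eq_i.
Qed.

Lemma entry_index m (T : tensor R m) (x : Defs.index m) :
  entry T (fun l => x l) = T x.
Proof.
rewrite /entry; case: pickP => [y /forallP eq_yx|/(_ x)/forallP[] //].
by congr (T _); apply/ffunP => l; apply/val_inj/eqP/eq_yx.
Qed.

Lemma entry_out m (T : tensor R m) i l : (m l <= i l)%N -> entry T i = 0.
Proof.
move=> le_mi; rewrite /entry; case: pickP => // x /forallP/(_ l)/eqP eq_xi.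
by have := ltn_ord (x l); rewrite eq_xi ltnNge le_mi.
Qed.

Section Kronecker.
Variable B : nat.
Local Notation idx := {ffun L -> 'I_B}.

(** The Kronecker product of the matrices [N l] applied to [phi].  The uniform
index bound B makes composition of such maps a matrix product in each mode,
although the modes of the tensors have different sizes. *)
Definition kron (N : L -> 'M[R]_B) (phi : idx -> R) (i : idx) : R :=
  \sum_(j : idx) (\prod_l N l (i l) (j l)) * phi j.

Lemma kron_mul N P phi i :
  kron N (kron P phi) i = kron (fun l => N l *m P l) phi i.
Proof.
rewrite /kron; under eq_bigr do rewrite big_distrr /=.
rewrite exchange_big; apply: eq_bigr => j _ /=.
under eq_bigr do rewrite mulrA -big_split /=.
rewrite -big_distrl /=; congr (_ * _).
rewrite -(bigA_distr_bigA (fun l b => N l (i l) b * P l b (j l))).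
by apply: eq_bigr => l _; rewrite mxE.
Qed.

Lemma eq_kron N N' phi phi' i : N =1 N' -> phi =1 phi' ->
  kron N phi i = kron N' phi' i.
Proof.
move=> eqN eq_phi; apply: eq_bigr => j _; rewrite eq_phi; congr (_ * _).
by apply: eq_bigr => l _; rewrite eqN.
Qed.

Lemma kron_id phi i : kron (fun=> 1%:M) phi i = phi i.
Proof.
rewrite /kron (bigD1 i) //= [X in _ + X]big1 ?addr0 => [|j nji].
  by rewrite big1 ?mul1r // => l _; rewrite mxE eqxx.
have [l nl] : exists l, i l != j l.
  apply/existsP; apply: contraNT nji => /existsPn eq_ij.
  by apply/eqP/ffunP => l; apply/esym/eqP; rewrite -[_ == _]negbK eq_ij.
by rewrite (bigD1 l) //= mxE (negPf nl) !mul0r.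
Qed.

(** A factor in a single mode only moves the index of that mode, as mode
products do. *)
Lemma kron_single l (P : 'M[R]_B) phi i :
  kron (fun l' => if l' == l then P else 1%:M) phi i =
  \sum_b P (i l) b * phi [ffun l' => if l' == l then b else i l'].
Proof.
pose up b : idx := [ffun l' => if l' == l then b else i l'].
rewrite /kron (bigID (fun j : idx => up (j l) == j)) /=.
rewrite [X in _ + X]big1 ?addr0 => [|j nj]; last first.
  have [l' nl'] : exists l', up (j l) l' != j l'.
    apply/existsP; apply: contraNT nj => /existsPn eq_j.
    by apply/eqP/ffunP => l'; apply/eqP; rewrite -[_ == _]negbK eq_j.
  move: nl'; rewrite ffunE; have [->|nll' nij] := eqVneq l' l.
    by rewrite eqxx.
  by rewrite (bigD1 l') //= (negPf nll') mxE (negPf nij) !mul0r.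
rewrite (reindex_onto up (fun j : idx => j l)) /= => [|j /eqP //].
apply: eq_big => [b|b _]; first by rewrite ffunE eqxx !eqxx.
rewrite (bigD1 l) //= eqxx ffunE eqxx big1 ?mulr1 // => l' nl'.
by rewrite (negPf nl') ffunE (negPf nl') mxE eqxx.
Qed.

(** Extension by zero, which matches the convention that entries out of bounds
are zero. *)
Definition pad k q (M : 'M[R]_(k, q)) : 'M[R]_B :=
  \matrix_(a, b)
    match insub (val a), insub (val b) with
    | Some a', Some b' => M a' b'
    | _, _ => 0
    end.

Lemma pad_in k q (M : 'M[R]_(k, q)) (a b : 'I_B) (a' : 'I_k) (b' : 'I_q) :
  a = a' :> nat -> b = b' :> nat -> pad M a b = M a' b'.
Proof. by move=> ea eb; rewrite mxE /= ea eb !valK. Qed.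

Lemma entry_mode_prod s l k q (M : 'M[R]_(k, q)) (T : tensor R s) (i : idx) :
  (q <= B)%N ->
  entry (mode_prod l M T) (fun l' => i l') =
  kron (fun l' => if l' == l then pad M else 1%:M)
       (fun j => entry T (fun l' => j l')) i.
Proof.
move=> le_qB; rewrite kron_single.
have [/forallP lt_i|/forallPn[l0]] :=
  boolP [forall l', i l' < set_mode s l k l']%N; last first.
  rewrite -leqNgt => le_i; rewrite (entry_out _ le_i) big1 // => b _.
  have [el|nl] := eqVneq l0 l; last first.
    rewrite (@entry_out _ _ _ l0) ?mulr0 // ffunE (negPf nl).
    by move: le_i; rewrite /set_mode (negPf nl).
  rewrite mxE insubN ?mul0r // -leqNgt.
  by move: le_i; rewrite el /set_mode eqxx.
pose x : Defs.index (set_mode s l k) := [ffun l' => Ordinal (lt_i l')].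
rewrite (@eq_entry _ _ _ (fun l' => x l')); last by move=> l'; rewrite ffunE.
rewrite entry_index ffunE.
(* The summand as a function on nat, to change the range from q to B. *)
pose F b := if insub b is Some b'
  then M (Defs.coord x) b' * entry T (set_mode (fun l' => i l') l b) else 0.
transitivity (\sum_(j < q) F j).
  apply: eq_bigr => j _; rewrite /F valK; congr (_ * _).
  by apply: eq_entry => l'; rewrite /set_mode ffunE.
rewrite (big_ord_widen_cond B xpredT F le_qB) big_mkcond /=.
apply: eq_bigr => b _; rewrite /F mxE /=.
have lt_il : (i l < k)%N by move: (lt_i l); rewrite /set_mode eqxx.
case: ltnP => [lt_bq|le_qb]; last first.
  rewrite [insub (b : nat)]insubN -?leqNgt //.
  by case: insub => *; rewrite mul0r.
rewrite (insubT (fun j => j < q)%N lt_bq) (insubT (fun j => j < k)%N lt_il).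
congr (M _ _ * _).
  by apply: val_inj; rewrite /= ffunE.
by apply: eq_entry => l'; rewrite /set_mode ffunE; case: eqP.
Qed.

(** Induction on the list of modes: the modes already treated carry their
matrix, the others the identity, and [kron_mul] merges the next mode, whose
factor in the product of the remaining ones is the identity since the list has
no repetition. *)
Lemma entry_mode_prods_seq m m' (M : forall l, 'M[R]_(m' l, m l)) ls s
    (T : tensor R s) (i : idx) :
  uniq ls -> (forall l, m l <= B)%N ->
  entry (mode_prods_seq M ls T) (fun l => i l) =
  kron (fun l => if l \in ls then pad (M l) else 1%:M)
       (fun j => entry T (fun l => j l)) i.
Proof.
move=> + le_mB; elim: ls s T i => [|l ls IHls] s T i /=.
  by move=> _; rewrite -[LHS](kron_id (fun j => entry T (fun l => j l))).
case/andP=> l_ls uniq_ls; rewrite IHls //.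
under eq_kron => [//|j] do rewrite entry_mode_prod //.
rewrite kron_mul; apply: eq_kron => // l'; rewrite in_cons.
have [->|_] := eqVneq l' l; first by rewrite (negPf l_ls) mul1mx.
by case: ifP; rewrite mulmx1.
Qed.

End Kronecker.

(** Going back from the uniform index bound to the shape of the tensor. *)
Lemma sum_index B m (F : {ffun L -> 'I_B} -> R) (G : Defs.index m -> R) :
  (forall l, m l <= B)%N ->
  (forall j : {ffun L -> 'I_B}, [exists l, (m l <= j l)%N] -> F j = 0) ->
  (forall (j : {ffun L -> 'I_B}) (x : Defs.index m),
     (forall l, j l = x l :> nat) -> F j = G x) ->
  \sum_j F j = \sum_x G x.
Proof.
move=> le_mB F0 FG.
pose h (x : Defs.index m) : {ffun L -> 'I_B} :=
  [ffun l => widen_ord (le_mB l) (x l)].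
have h_inj : injective h.
  move=> x y /ffunP eq_h; apply/ffunP => l; apply: val_inj.
  by have := congr1 val (eq_h l); rewrite !ffunE.
transitivity (\sum_(j in h @: [set: Defs.index m]) F j).
  rewrite [RHS]big_mkcond /=; apply: eq_bigr => j _; case: ifPn => // nj.
  apply: F0; apply: contraNT nj => /existsPn lt_j.
  have lt_jm l : (j l < m l)%N by rewrite ltnNge lt_j.
  apply/imsetP; exists (finfun (fun l => Ordinal (lt_jm l)) : Defs.index m) => //.
  by apply/ffunP => l; apply: val_inj; rewrite !ffunE.
rewrite big_imset /=; last by move=> x y _ _; apply: h_inj.
apply: eq_big => [x|x _]; first by rewrite inE.
by apply: FG => l; rewrite ffunE.
Qed.

Lemma entry_mode_prods m m' (M : forall l, 'M[R]_(m' l, m l))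
    (T : tensor R m) (x : Defs.index m') :
  entry (mode_prods M T) (fun l => x l) =
  \sum_(j : Defs.index m) (\prod_l M l (x l) (j l)) * T j.
Proof.
pose B := (\sum_l (m l + m' l))%N.
have le_B l : (m l + m' l <= B)%N by rewrite /B (bigD1 l) //= leq_addr.
have le_mB l : (m l <= B)%N by apply: leq_trans (le_B l); rewrite leq_addr.
have le_m'B l : (m' l <= B)%N by apply: leq_trans (le_B l); rewrite leq_addl.
pose i : {ffun L -> 'I_B} := [ffun l => widen_ord (le_m'B l) (x l)].
rewrite (@eq_entry _ _ _ (fun l => i l)); last by move=> l; rewrite ffunE.
rewrite entry_mode_prods_seq ?enum_uniq //; apply: sum_index => //.
  by move=> j /existsP[l le_mj]; rewrite (entry_out T le_mj) mulr0.
move=> j y eq_jy; congr (_ * _); last first.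
  by rewrite -entry_index; apply: eq_entry => l; rewrite eq_jy.
apply: eq_bigr => l _; rewrite mem_enum; apply: pad_in => //.
by rewrite ffunE.
Qed.

End TensorEntries.

(** * Results and costs of the elementary operations *)

Section SequentialUpdates.
Variables (V : nmodType) (X : finType) (I : Type).
Variable h : I -> {ffun X -> V} -> counted {ffun X -> V}.

Lemma foldl_update (delta : I -> X -> V) r acc :
  (forall i f, (h i f).1 = [ffun x => f x + delta i x]) ->
  (foldl (fun acc i => cbind acc (h i)) acc r).1 =
  [ffun x => acc.1 x + \sum_(i <- r) delta i x].
Proof.
move=> hE; elim: r acc => [|i r IHr] acc /=.
  by apply/ffunP => x; rewrite ffunE big_nil addr0.
by rewrite IHr /= hE; apply/ffunP => x; rewrite !ffunE big_cons addrA.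
Qed.

Lemma foldl_update_cost (R : numDomainType) (c : I -> R) r acc :
  (forall i f, (h i f).2%:R <= c i) ->
  (foldl (fun acc i => cbind acc (h i)) acc r).2%:R <=
  acc.2%:R + \sum_(i <- r) c i.
Proof.
move=> h_cost; elim: r acc => [|i r IHr] acc /=; first by rewrite big_nil addr0.
apply: (le_trans (IHr _)) => /=; rewrite big_cons natrD addrA lerD2r lerD2l.
exact: h_cost.
Qed.

End SequentialUpdates.

Lemma cdotE (R : realFieldType) (J : finType) (a b : J -> R) :
  cdot a b = (\sum_j a j * b j, (2 * #|J|)%N).
Proof.
rewrite /cdot -big_enum cardE /cret.
set f := foldl _; suff E r s c :
    f (s, c) r = (s + \sum_(j <- r) a j * b j, (c + 2 * size r)%N).
  by rewrite E /= add0r.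
elim: r s c => [|j r IHr] s c /=; first by rewrite big_nil addr0 addn0.
by rewrite /f /= -/f IHr /= big_cons addrA; congr (_, _); lia.
Qed.

Section NodePoints.
Variables d n : nat.
Implicit Types tau sigma : node d n.

Lemma mem_points tau x : (x \in points tau) = [forall l, x l \in tau l].
Proof. by rewrite inE. Qed.

(** Inverse of [rank]: the grid point at a given position of the node. *)
Definition point tau (j : Defs.index (fun l => #|tau l|)) : grid d n :=
  [ffun l => enum_val (j l)].

Lemma rank_point tau (j : Defs.index (fun l => #|tau l|)) l :
  rank tau (point j) l = j l.
Proof.
rewrite /rank ffunE /enum_val index_uniq ?enum_uniq //.
by rewrite -cardE.
Qed.

Lemma point_inj tau : injective (@point tau).
Proof.
move=> i j eq_ij; apply/ffunP => l; apply: val_inj => /=.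
by rewrite -!rank_point eq_ij.
Qed.

Lemma points_image tau :
  points tau = [set point j | j : Defs.index (fun l => #|tau l|)].
Proof.
apply/setP => x; apply/idP/imsetP => [|[j _ ->]]; rewrite mem_points.
  move/forallP => tau_x.
  exists (finfun (fun l => enum_rank_in (tau_x l) (x l)) :
            Defs.index (fun l => #|tau l|)) => //.
  by apply/ffunP => l; rewrite !ffunE enum_rankK_in.
by apply/forallP => l; rewrite ffunE enum_valP.
Qed.

Lemma card_index (L : finType) (m : L -> nat) :
  #|Defs.index m| = (\prod_l m l)%N.
Proof.
rewrite card_dep_ffun foldrE big_map big_enum /=.
by apply: eq_bigr => l _; rewrite card_ord.
Qed.

Lemma card_points tau : #|points tau| = (\prod_l #|tau l|)%N.
Proof.
by rewrite points_image card_imset ?card_index //; apply: point_inj.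
Qed.

Lemma sum_points (R : nmodType) tau (F : grid d n -> R) :
  \sum_(x in points tau) F x = \sum_j F (@point tau j).
Proof.
rewrite points_image big_imset /=; last by move=> i j _ _; apply: point_inj.
by apply: eq_bigl => j; rewrite inE.
Qed.

End NodePoints.

Section ModeProductAlgorithm.
Variables (R : realFieldType) (L : finType).

Lemma cmode_prodE m (l : L) k q (M : 'M[R]_(k, q)) (T : tensor R m) :
  cmode_prod l M T =
    (mode_prod l M T, (#|Defs.index (set_mode m l k)| * (2 * q))%N).
Proof.
rewrite /cmode_prod /ctab; congr (_, _).
  by apply/ffunP => i; rewrite !ffunE cdotE.
under eq_bigr do rewrite cdotE card_ord.
by rewrite sum_nat_const.
Qed.

Variables (m m' : L -> nat) (M : forall l, 'M[R]_(m' l, m l)).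

Lemma cmode_prodsE (T : tensor R m) : (cmode_prods M T).1 = mode_prods M T.
Proof.
rewrite /cmode_prods /mode_prods; move: (enum L) => ls.
suff E s (T' : tensor R s) :
    (cmode_prods_seq M ls T').1 = mode_prods_seq M ls T' by [].
elim: ls s T' => // l ls IHls s T'.
by rewrite [LHS]IHls cmode_prodE.
Qed.

(** Whatever the order of the modes, all intermediate shapes are bounded by F,
and the product over mode l costs 2 (m' l) (m l) F^(#|L| - 1) operations at
most.  The hypothesis on m' l * m l keeps one power of F out of the bound: one
of the two sizes is always the rank q, for compression as for expansion. *)
Lemma cmode_prods_cost F q (T : tensor R m) :
  (forall l, m l <= F)%N -> (forall l, m' l <= F)%N ->
  (forall l, m' l * m l <= q * F)%N ->
  ((cmode_prods M T).2 <= #|L| * (2 * q * F ^ #|L|))%N.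
Proof.
move=> le_m le_m' le_mm'; rewrite /cmode_prods [X in (X * _)%N]cardE.
move: (enum L) => ls.
suff E s (T' : tensor R s) : (forall l, s l <= F)%N ->
    ((cmode_prods_seq M ls T').2 <= size ls * (2 * q * F ^ #|L|))%N by apply: E.
elim: ls s T' => // l ls IHls s T' le_s.
rewrite [(cmode_prods_seq _ _ _).2]/(_ + _)%N cmode_prodE mulSn leq_add ?IHls //; last first.
  by move=> l'; rewrite /set_mode; case: eqP.
rewrite card_index (bigD1 l) //= set_modeE.
have : (\prod_(l' | l' != l) set_mode s l (m' l) l' <= F ^ #|L|.-1)%N.
  rewrite -(cardC1 l) -prod_nat_const leq_prod // => l' /negPf nl'.
  by rewrite /set_mode nl'.
have L_gt0 : (0 < #|L|)%N by apply/card_gt0P; exists l.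
rewrite -{2}(prednK L_gt0) expnS; have := le_mm' l.
move: (m' l) (m l) (\prod_(_ | _) _)%N (F ^ _)%N => a b X Y le_ab leXY.
have -> : (a * X * (2 * b) = 2 * ((a * b) * X))%N by lia.
have -> : (2 * q * (F * Y) = 2 * ((q * F) * Y))%N by lia.
by rewrite leq_mul2l /= leq_mul.
Qed.

End ModeProductAlgorithm.

Section Updates.
Variables (R : realFieldType) (d n p : nat).
Local Notation vector := {ffun grid d n -> R}.
Implicit Types (tau sigma : node d n) (u f : vector).

Lemma cupdateE tau f (g : {x | x \in points tau} -> counted R) (h : grid d n -> R) :
  (forall x, (g x).1 = h (val x)) ->
  (cupdate f g).1 = [ffun x => f x + if x \in points tau then h x else 0].
Proof.
move=> gh; apply/ffunP => x; rewrite /cupdate /= !ffunE.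
have [tau_x|tau'x] := boolP (x \in points tau); last by rewrite insubN ?addr0.
by rewrite (insubT (fun x => x \in points tau) tau_x) ffunE /= gh.
Qed.

Lemma cupdate_cost tau f (g : {x | x \in points tau} -> counted R) c :
  (forall x, (g x).2 = c) -> (cupdate f g).2 = (#|points tau| * c.+1)%N.
Proof.
move=> gc; rewrite /cupdate /cbind /= addn0.
under eq_bigr do rewrite gc addn1.
by rewrite sum_nat_const card_sig.
Qed.

Lemma dense_updateE tau sigma (D : Defs.dense R tau sigma) u f A :
  (forall (x : {x | x \in points tau}) (y : {y | y \in points sigma}),
     A (val x) (val y) = D x y) ->
  (dense_update D u f).1 = [ffun x => f x +
     if x \in points tau then \sum_(y in points sigma) A x y * u y else 0].
Proof.
move=> eqA; apply: (@cupdateE _ _ _ (fun x => \sum_(y in points sigma) A x y * u y)).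
move=> x; rewrite cdotE /=; under eq_bigr do rewrite -eqA.
exact/esym/(big_sub (points sigma) (fun y => A (val x) y * u y)).
Qed.

Lemma dense_update_cost tau sigma (D : Defs.dense R tau sigma) u f :
  (dense_update D u f).2 = (#|points tau| * (2 * #|points sigma|).+1)%N.
Proof. by apply: cupdate_cost => x; rewrite cdotE card_sig. Qed.

(** Splitting a multi-index over the 2d modes of a block into its row part and
its column part. *)
Lemma sum_index_sum (V : nmodType) (m : 'I_d + 'I_d -> nat)
    (F : Defs.index m -> V) (G : Defs.index (m \o inl) -> Defs.index (m \o inr) -> V) :
  (forall (c : Defs.index m) (a : Defs.index (m \o inl))
     (b : Defs.index (m \o inr)), (forall l, c (inl l) = a l) -> (forall l, c (inr l) = b l) ->
     F c = G a b) ->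
  \sum_c F c = \sum_a \sum_b G a b.
Proof.
move=> FG; rewrite pair_big /=.
pose h (ab : Defs.index (m \o inl) * Defs.index (m \o inr)) : Defs.index m :=
  finfun (fun l => match l return 'I_(m l) with
                   | inl l => ab.1 l | inr l => ab.2 l end).
pose h' (c : Defs.index m) : Defs.index (m \o inl) * Defs.index (m \o inr) :=
  ((finfun (fun l => c (inl l)) : Defs.index (m \o inl)),
   (finfun (fun l => c (inr l)) : Defs.index (m \o inr))).
rewrite (reindex h) /=; last first.
  exists h' => [[a b] _|c _]; rewrite /h /h'.
    by congr (_, _); apply/ffunP => l; rewrite !ffunE.
  by apply/ffunP => -[] l; rewrite !ffunE.
by apply: eq_bigr => -[a b] _; apply: FG => l; rewrite ffunE.
Qed.

Lemma entry_tucker tau sigma (B : tucker R p tau sigma)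
    (i : Defs.index (fun l => #|tau l|)) (j : Defs.index (fun l => #|sigma l|)) :
  entry (tucker_tensor B)
    (fun l => match l with inl a => i a : nat | inr b => j b : nat end) =
  \sum_(a : Defs.index (fun _ => p)) \sum_(b : Defs.index (fun _ => p))
     (\prod_l tU B l (i l) (a l)) * (\prod_l tV B l (j l) (b l)) *
     entry (tcore B) (fun l => match l with
                               | inl q => a q : nat
                               | inr q => b q : nat
                               end).
Proof.
pose x := finfun (fun l => match l return
     'I_(match l with inl a => #|tau a| | inr b => #|sigma b| end) with
   | inl a => i a | inr b => j b end) : Defs.index _.
rewrite (@eq_entry _ _ _ _ _ (fun l => x l)); last by case=> l; rewrite ffunE.
rewrite /tucker_tensor entry_mode_prods.
apply: (@sum_index_sum _ (fun _ => p)) => c a b eq_a eq_b.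
rewrite big_sumType /=; congr (_ * _ * _).
- by apply: eq_bigr => l _; rewrite ffunE eq_a.
- by apply: eq_bigr => l _; rewrite ffunE eq_b.
by rewrite -entry_index; apply: eq_entry => -[] l; rewrite ?eq_a ?eq_b.
Qed.

(** Both sides are the sum over j, a and b of U (i, a) G (a, b) V (j, b) u (j);
the algorithm sums over j first, then b, then a. *)
Lemma admissible_updateE tau sigma (B : tucker R p tau sigma) u f A :
  (forall x y, x \in points tau -> y \in points sigma ->
     A x y = entry (tucker_tensor B) (fun l => match l with
                          | inl a => rank tau x a
                          | inr b => rank sigma y b
                          end)) ->
  (admissible_update B u f).1 = [ffun x => f x +
     if x \in points tau then \sum_(y in points sigma) A x y * u y else 0].
Proof.
move=> eqA.
apply: (@cupdateE _ _ _ (fun x => \sum_(y in points sigma) A x y * u y)).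
move=> [x tau_x] /=; move: (tau_x); rewrite points_image => /imsetP[i _ def_x].
rewrite !cmode_prodsE sum_points def_x.
rewrite (eq_entry _ (i' := fun l => i l)); last exact: rank_point.
rewrite entry_mode_prods.
transitivity (\sum_(j : Defs.index (fun l => #|sigma l|))
    \sum_(a : Defs.index (fun _ : 'I_d => p))
    \sum_(b : Defs.index (fun _ : 'I_d => p)) (\prod_l tU B l (i l) (a l)) *
    ((\prod_l tV B l (j l) (b l)) *
     entry (tcore B) (fun l => match l with
                               | inl q => a q : nat
                               | inr q => b q : nat
                               end)) * Defs.reshape sigma u j).
  rewrite exchange_big; apply: eq_bigr => a _; rewrite exchange_big /=.
  rewrite ffunE cdotE /= big_distrr; apply: eq_bigr => b _ /=.
  rewrite entry_mode_prods !big_distrr; apply: eq_bigr => j _ /=.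
  under [X in _ * (_ * (X * _)) = _]eq_bigr do rewrite mxE.
  by ring.
apply: eq_bigr => j _; rewrite eqA -?def_x //; last first.
  by rewrite points_image; apply/imsetP; exists j.
rewrite (eq_entry _ (i' := fun l => match l with
    | inl a => i a : nat | inr b => j b : nat end)); last first.
  by case=> l; rewrite ?def_x rank_point.
rewrite entry_tucker big_distrl; apply: eq_bigr => a _.
rewrite big_distrl; apply: eq_bigr => b _ /=.
by rewrite ffunE mulrA.
Qed.

End Updates.

Section Costs.
Variables (R : realFieldType) (d n p : nat).
Local Notation vector := {ffun grid d n -> R}.

Lemma card_index_const q : #|Defs.index (fun _ : 'I_d => q)| = (q ^ d)%N.
Proof. by rewrite card_index prod_nat_const card_ord. Qed.

Lemma ccontract_cost m (G : core R d p) (W : tensor R m) :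
  (ccontract G W).2 = (p ^ d * (2 * p ^ d))%N.
Proof.
rewrite /ccontract /ctab /=.
under eq_bigr do rewrite cdotE card_index_const.
by rewrite sum_nat_const card_index_const.
Qed.

Lemma admissible_update_cost (tau sigma : node d n) (B : tucker R p tau sigma)
    (u f : vector) F :
  (p <= F)%N -> (forall l, #|tau l| <= F)%N -> (forall l, #|sigma l| <= F)%N ->
  ((admissible_update B u f).2 <=
     (4 * d).+1 * (p.+1 * F ^ d) + 2 * (p ^ d * p ^ d))%N.
Proof.
move=> le_p le_tau le_sigma.
have -> : (admissible_update B u f).2 =
  ((cmode_prods (fun l => (tV B l)^T)%R (Defs.reshape sigma u)).2 +
   (p ^ d * (2 * p ^ d) +
    ((cmode_prods (tU B)
       (ccontract (tcore B)
          (cmode_prods (fun l => (tV B l)^T)%R (Defs.reshape sigma u)).1).1).2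
     + #|points tau|)))%N.
  rewrite -(ccontract_cost (tcore B)
     (cmode_prods (fun l => (tV B l)^T)%R (Defs.reshape sigma u)).1).
  congr (_ + (_ + (_ + _)))%N.
  by rewrite (@cupdate_cost _ _ _ _ _ _ 0) ?muln1.
have le_V : ((cmode_prods (fun l => (tV B l)^T)%R (Defs.reshape sigma u)).2
    <= d * (2 * p * F ^ d))%N.
  rewrite -[X in (_ <= X * (_ * _ ^ X))%N](card_ord d).
  by apply: cmode_prods_cost => // l; rewrite leq_mul2l le_sigma orbT.
set H := (ccontract _ _).1.
have le_U : ((cmode_prods (tU B) H).2 <= d * (2 * p * F ^ d))%N.
  rewrite -[X in (_ <= X * (_ * _ ^ X))%N](card_ord d).
  by apply: cmode_prods_cost => // l; rewrite mulnC leq_mul2l le_tau orbT.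
have le_points : (#|points tau| <= F ^ d)%N.
  rewrite card_points -[d in (_ ^ d)%N](card_ord d) -prod_nat_const.
  exact: leq_prod.
move: (p ^ d)%N (F ^ d)%N le_V le_U le_points => P E; nia.
Qed.

End Costs.

(** * Correctness of the recursion *)

Section ClusterTrees.
Variables d n : nat.
Implicit Types t s : ctree d n.

Lemma cluster_children t : cluster_subtree t -> ~~ is_leaf t ->
  [/\ points (croot t) = \bigcup_i points (croot (child t i)),
      forall i j, i != j ->
        [disjoint points (croot (child t i)) & points (croot (child t j))]
    & forall i, cluster_subtree (child t i)].
Proof.
case: t => tau k c [_ part sub_c]; rewrite /is_leaf /= => k_neq0.
by case: part => [k0|[]]; first by rewrite k0 in k_neq0.
Qed.

Lemma sum_children (V : nmodType) t (F : grid d n -> V) :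
  cluster_subtree t -> ~~ is_leaf t ->
  \sum_(x in points (croot t)) F x =
  \sum_i \sum_(x in points (croot (child t i))) F x.
Proof.
move=> sub_t nleaf_t; have [-> disj _] := cluster_children sub_t nleaf_t.
exact: partition_disjoint_bigcup.
Qed.

End ClusterTrees.

Section Correctness.
Variables (R : realFieldType) (d n p : nat) (adm : node d n -> node d n -> Prop).
Local Notation vector := {ffun grid d n -> R}.

Lemma htlr_updateE (A : grid d n -> grid d n -> R) (u : vector) t s
    (B : block_tree adm t s) (S : htlr_storage R p B) (f : vector) :
  cluster_subtree t -> cluster_subtree s -> represents A S ->
  (htlr_update u S f).1 = [ffun x => f x +
     if x \in points (croot t)
     then \sum_(y in points (croot s)) A x y * u y else 0].
Proof.
elim: t s / B S f => [t s adm_ts|t s nadm_ts leaf_ts|t s nadm_ts nleaf_ts B IHB]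
  S f sub_t sub_s repS /=.
- exact: admissible_updateE.
- exact: dense_updateE.
move: (nleaf_ts); rewrite negb_or => /andP[nleaf_t nleaf_s].
have [_ _ sub_ct] := cluster_children sub_t nleaf_t.
have [_ _ sub_cs] := cluster_children sub_s nleaf_s.
rewrite (foldl_update _ _ (delta := fun ij x =>
    if x \in points (croot (child t ij.1))
    then \sum_(y in points (croot (child s ij.2))) A x y * u y else 0));
  last by move=> [i j] g; apply: IHB.
apply/ffunP => x; rewrite !ffunE /=; congr (_ + _).
rewrite big_enum /= -(pair_bigA _ (fun i j =>
    if x \in points (croot (child t i))
    then \sum_(y in points (croot (child s j))) A x y * u y else 0)) /=.
(* A function supported at x turns membership of x into a sum over points, to
   which [sum_children] applies for the rows as well. *)
pose g x' := if x' == x then \sum_(y in points (croot s)) A x y * u y else 0.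
have sum_g t' : \sum_(x' in points (croot t')) g x' =
    if x \in points (croot t')
    then \sum_(y in points (croot s)) A x y * u y else 0.
  rewrite -big_mkcondr /=; case: ifP => t'x.
    rewrite (big_pred1 x) // => x' /=.
    by have [->|] := eqVneq x' x; rewrite ?t'x ?andbF.
  by rewrite big_pred0 // => x'; have [->|] := eqVneq x' x; rewrite ?t'x ?andbF.
rewrite -[RHS]sum_g sum_children //; apply: eq_bigr => i _.
rewrite sum_g; case: ifP => _; last by rewrite big1.
by rewrite -sum_children.
Qed.

End Correctness.

(** * Boxes of a level and pairs of nearby points *)

Section Boxes.
Variables d n : nat.
Local Open Scope nat_scope.

Definition convex (S : {set 'I_n}) : Prop :=
  forall x y z : 'I_n, x \in S -> z \in S -> x <= y <= z -> y \in S.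

(** The interval between two points of a convex set consists of elements of the
set, so it has at most as many points as the set. *)
Lemma convex_spread (S : {set 'I_n}) (x y : 'I_n) :
  convex S -> x \in S -> y \in S -> y < x + #|S|.
Proof.
move=> conv_S Sx Sy; case: (leqP x y) => [le_xy|lt_yx]; last first.
  by rewrite (ltn_trans lt_yx) // -addn1 leq_add2l card_gt0; apply/set0Pn; exists x.
suff: (y.+1 - x <= #|S|) by rewrite leq_subLR.
rewrite cardE -(size_iota x (y.+1 - x)) -(size_map val (enum S)).
apply: uniq_leq_size; first exact: iota_uniq.
move=> k; rewrite mem_iota subnKC ?(leqW le_xy) // => /andP[le_xk lt_ky].
have lt_kn : k < n by apply: leq_trans lt_ky (ltn_ord y).
apply/mapP; exists (Ordinal lt_kn) => //; rewrite mem_enum.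
by apply: (conv_S x _ y); rewrite //= le_xk.
Qed.

Lemma halves_convex (S S1 S2 : {set 'I_n}) :
  halves S S1 S2 -> convex S -> convex S1 /\ convex S2.
Proof.
case=> -> lt12 _ _ conv_S; split=> x y z Sx Sz /andP[le_xy le_yz].
  have /setUP[//|S2y] : y \in S1 :|: S2.
    by apply: (conv_S x _ z); rewrite ?inE ?Sx ?Sz ?le_xy.
  by have := lt12 _ _ Sz S2y; rewrite ltnNge le_yz.
have /setUP[S1y|//] : y \in S1 :|: S2.
  by apply: (conv_S x _ z); rewrite ?inE ?Sx ?Sz ?le_xy ?orbT.
by have := lt12 _ _ S1y Sx; rewrite ltnNge le_xy.
Qed.

Lemma halves_card (S S1 S2 : {set 'I_n}) f :
  halves S S1 S2 -> f <= #|S| <= f.+1 ->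
  f %/ 2 <= #|S1| <= (f %/ 2).+1 /\ f %/ 2 <= #|S2| <= (f %/ 2).+1.
Proof.
case=> -> lt12 le12 le21; rewrite cardsU.
have -> : S1 :&: S2 = finset.set0.
  apply/setP => x; rewrite !inE; apply/negP => /andP[S1x S2x].
  by have := lt12 _ _ S1x S2x; rewrite ltnn.
rewrite cards0; lia.
Qed.

(** Up to rounding, the length of the index intervals of level k. *)
Definition side k := n %/ 2 ^ k.

Lemma sideS k : side k.+1 = side k %/ 2.
Proof. by rewrite /side expnSr divnMA. Qed.

Definition box_at k (tau : node d n) : Prop :=
  forall l, convex (tau l) /\ side k <= #|tau l| <= (side k).+1.

Lemma box_at_full : box_at 0 (@full_node d n).
Proof.
move=> l; rewrite ffunE; split=> [x y z _ _ _|]; first by rewrite inE.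
by rewrite cardsT card_ord /side divn1 leqnn leqnSn.
Qed.

Lemma card_box k tau : box_at k tau ->
  side k ^ d <= #|points tau| <= (side k).+1 ^ d.
Proof.
move=> box_tau; rewrite card_points.
rewrite -[X in side k ^ X](card_ord d) -[X in (side k).+1 ^ X](card_ord d).
rewrite -!prod_nat_const; apply/andP; split; apply: leq_prod => l _;
  by case: (box_tau l) => _ /andP[].
Qed.

(** A node that must be split has a child, so that being a leaf and being small
are the same for a uniform partition. *)
Lemma nonempty_subbox (tau lo hi : node d n) :
  (forall l, halves (tau l) (lo l) (hi l)) -> points tau != finset.set0 ->
  exists b, points (subbox lo hi b) != finset.set0.
Proof.
move=> halved /set0Pn[x]; rewrite mem_points => /forallP tau_x.
exists [ffun l => x l \in hi l]; apply/set0Pn; exists x.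
rewrite mem_points; apply/forallP => l; rewrite !ffunE.
case: ifPn => // hi'x; have [eq_tau _ _ _] := halved l.
by have := tau_x l; rewrite eq_tau inE (negPf hi'x) orbF.
Qed.

Lemma leaf_small N0 (t : ctree d n) :
  cluster_subtree t -> uniform_partition N0 t -> is_leaf t ->
  #|points (croot t)| <= N0.
Proof.
case: t => tau k c [tau_n0 _ _] /= [part _]; rewrite /is_leaf /= => /eqP k0.
case: leqP part => // _ [lo [hi [halved /perm_size]]].
rewrite size_image card_ord k0 => /esym/size0nil no_child.
have [b nb] := nonempty_subbox halved tau_n0.
suff: subbox lo hi b \in [::] by [].
by rewrite -no_child mem_filter nb map_f ?mem_enum.
Qed.

Section Children.
Variables (N0 : nat) (t : ctree d n).
Hypotheses (part_t : uniform_partition N0 t) (nleaf_t : ~~ is_leaf t).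

Lemma nonleaf_large : N0 < #|points (croot t)|.
Proof.
case: t part_t nleaf_t => tau k c [] /=; case: leqP => // _ k0 _.
by rewrite /is_leaf /= k0.
Qed.

Lemma child_partition i : uniform_partition N0 (child t i).
Proof. by case: t part_t i => tau k c []. Qed.

Lemma child_subbox : exists lo hi : node d n,
  [/\ forall l, halves (croot t l) (lo l) (hi l), arity t <= 2 ^ d
    & forall i, exists b, croot (child t i) = subbox lo hi b].
Proof.
move: nonleaf_large; case: t part_t => tau k c [] /= part _ lt_tau.
move: part; rewrite leqNgt lt_tau /= => -[lo [hi [halved perm_c]]].
exists lo, hi; split=> // [|i].
  have := perm_size perm_c; rewrite size_image card_ord => ->.
  rewrite size_filter (leq_trans (count_size _ _)) // size_map -cardE.
  by rewrite card_ffun card_bool card_ord.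
have : croot (c i) \in [seq croot (c i) | i : 'I_k].
  by rewrite map_f ?mem_enum.
by rewrite (perm_mem perm_c) mem_filter => /andP[_ /mapP[b _ ->]]; exists b.
Qed.

Lemma arity_le : arity t <= 2 ^ d.
Proof. by have [lo [hi []]] := child_subbox. Qed.

Lemma child_box k i : box_at k (croot t) -> box_at k.+1 (croot (child t i)).
Proof.
move=> box_t; have [lo [hi [halved _ /(_ i)[b ->]]]] := child_subbox => l.
have [conv_t card_t] := box_t l.
have [conv1 conv2] := halves_convex (halved l) conv_t.
have [card1 card2] := halves_card (halved l) card_t.
by rewrite sideS ffunE; case: (b l).
Qed.

End Children.

Definition nearby g (x y : grid d n) :=
  [forall l, (x l < y l + g) && (y l < x l + g)].

Lemma card_nearby g x : #|[set y | nearby g x y]| <= (2 * g) ^ d.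
Proof.
pose tau : node d n := [ffun l => [set j : 'I_n | (x l < j + g) && (j < x l + g)]].
have -> : [set y | nearby g x y] = points tau.
  apply/setP => y; rewrite mem_points inE /nearby.
  by apply: eq_forallb => l; rewrite ffunE inE.
rewrite card_points -[d in _ ^ d](card_ord d) -prod_nat_const.
apply: leq_prod => l _; rewrite ffunE cardE.
rewrite -(size_iota (x l - g) (2 * g)) -(size_map val).
apply: uniq_leq_size; first by rewrite map_inj_uniq ?enum_uniq //; apply: val_inj.
move=> _ /mapP[j + ->]; rewrite mem_enum inE mem_iota => /andP[] /=.
set a := nat_of_ord _; set b := nat_of_ord _ => *; lia.
Qed.

Definition nearby_pairs g (tau sigma : node d n) : nat :=
  \sum_(x in points tau) \sum_(y in points sigma) nearby g x y.

Lemma nearby_pairs_full g :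
  nearby_pairs g (@full_node d n) (@full_node d n) <= n ^ d * (2 * g) ^ d.
Proof.
have all_in x : x \in points (@full_node d n).
  by rewrite mem_points; apply/forallP => l; rewrite ffunE inE.
apply: (@leq_trans (\sum_(x : grid d n) (2 * g) ^ d)).
  rewrite /nearby_pairs (eq_bigl xpredT) //; apply: leq_sum => x _.
  apply: leq_trans (card_nearby g x); rewrite -sum1_card big_mkcond.
  rewrite [X in _ <= X]big_mkcond; apply: leq_sum => y _.
  by rewrite all_in inE; case: (nearby g x y).
by rewrite sum_nat_const card_ffun !card_ord.
Qed.

Lemma nearby_pairs_all g (tau sigma : node d n) :
  (forall x y, x \in points tau -> y \in points sigma -> nearby g x y) ->
  nearby_pairs g tau sigma = #|points tau| * #|points sigma|.
Proof.
move=> all_near; rewrite /nearby_pairs -sum_nat_const; apply: eq_bigr => x tau_x.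
by rewrite -sum1_card; apply: eq_bigr => y sigma_y; rewrite all_near.
Qed.

(** The reason for counting pairs of points instead of blocks: the count of a
branch is the sum of the counts of its children. *)
Lemma nearby_pairs_children g (t s : ctree d n) :
  cluster_subtree t -> cluster_subtree s -> ~~ is_leaf t -> ~~ is_leaf s ->
  nearby_pairs g (croot t) (croot s) =
  \sum_i \sum_j nearby_pairs g (croot (child t i)) (croot (child s j)).
Proof.
move=> sub_t sub_s nleaf_t nleaf_s.
rewrite /nearby_pairs (sum_children _ sub_t nleaf_t); apply: eq_bigr => i _ /=.
rewrite [RHS]exchange_big; apply: eq_bigr => x _ /=.
by rewrite (sum_children _ sub_s nleaf_s).
Qed.

End Boxes.

(** * Cost of a block *)

Section BlockCost.
Variables (R : realFieldType) (d n n0 p : nat) (adm : node d n -> node d n -> Prop).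
Local Notation vector := {ffun grid d n -> R}.
Local Notation side := (side n).
Hypotheses (d_gt0 : (0 < d)%N) (n0_gt0 : (0 < n0)%N).
Hypotheses (le_pn0 : (p <= n0)%N) (le_n0p : (n0 <= 2 * p)%N).

Definition well_cut k (t : ctree d n) : Prop :=
  [/\ cluster_subtree t, uniform_partition (n0 ^ d) t & box_at k (croot t)].

Lemma well_cut_child k t i : well_cut k t -> ~~ is_leaf t ->
  well_cut k.+1 (child t i).
Proof.
case=> sub_t part_t box_t nleaf_t; have [_ _ sub_c] := cluster_children sub_t nleaf_t.
split; first exact: sub_c.
  exact: child_partition.
exact: child_box part_t nleaf_t _ _ box_t.
Qed.

Lemma side_nonleaf k t : well_cut k t -> ~~ is_leaf t -> (n0 <= side k)%N.
Proof.
case=> sub_t part_t box_t nleaf_t.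
have lt_t := nonleaf_large part_t nleaf_t.
have /andP[_ le_t] := card_box box_t.
by have := leq_trans lt_t le_t; rewrite ltn_exp2r.
Qed.

Lemma leaf_side k t : well_cut k t -> is_leaf t -> (side k <= n0)%N.
Proof.
case=> sub_t part_t box_t leaf_t.
have /andP[le_t _] := card_box box_t.
by have := leq_trans le_t (leaf_small sub_t part_t leaf_t); rewrite leq_exp2r.
Qed.

Definition is_branch t s (B : block_tree adm t s) : bool :=
  if B is NonLeaf _ _ _ _ _ then true else false.

(** Bound for a leaf of level k+1, the sides of which are at most [side k].  The
first summand is for the mode products and the final update of an admissible
leaf; the second one dominates both the contraction of its core and the product
with an inadmissible leaf, whose clusters have at most (4p)^d points each. *)
Definition leaf_cost k : nat :=
  (4 * d).+1 * (p.+1 * side k ^ d) + 3 * ((4 * p) ^ d * (4 * p) ^ d).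

Lemma leaf_update_cost k (u f : vector) t s (B : block_tree adm t s)
    (S : htlr_storage R p B) :
  (n0 <= side k)%N -> well_cut k.+1 t -> well_cut k.+1 s -> ~~ is_branch B ->
  ((htlr_update u S f).2 <= leaf_cost k)%N.
Proof.
case: B S => {}t {}s => [adm_ts|nadm_ts leaf_ts|//] S le_n0 t_cut s_cut _.
  have le_side t' : well_cut k.+1 t' -> forall l, (#|croot t' l| <= side k)%N.
    case=> _ _ box_t' l; have [_ /andP[_]] := box_t' l; rewrite sideS.
    by move: n0_gt0 le_n0; lia.
  apply: leq_trans (admissible_update_cost S u f (leq_trans le_pn0 le_n0)
                      (le_side t t_cut) (le_side s s_cut)) _.
  rewrite leq_add2l !expnMn.
  by rewrite leq_mul // leq_mul // leq_pmull ?expn_gt0.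
rewrite [X in (X.2 <= _)%N]/(dense_update S u f) dense_update_cost.
(* One of the clusters is a leaf, hence small, and both are at the same level. *)
have le_side : (side k.+1 <= n0)%N.
  by case/orP: (leaf_ts) => [/(leaf_side t_cut)|/(leaf_side s_cut)].
have le_card t' : well_cut k.+1 t' -> (#|points (croot t')| <= (4 * p) ^ d)%N.
  case=> _ _ /card_box/andP[_ le_t']; apply: leq_trans le_t' _.
  by rewrite leq_exp2r //; lia.
apply: leq_trans (leq_addl _ _).
have := le_card t t_cut; have := le_card s s_cut.
have : (0 < (4 * p) ^ d)%N by rewrite expn_gt0; lia.
by move: (_ ^ d)%N #|points _| #|points _| => X a b; nia.
Qed.

Variable D : nat.
Hypothesis D_depth : forall k, (n0 <= side k)%N -> (k < D)%N.
Hypothesis nearby_nadm : forall k tau sigma, (n0 <= side k)%N ->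
  box_at k tau -> box_at k sigma -> ~ adm tau sigma ->
  forall x y, x \in points tau -> y \in points sigma -> nearby (6 * side k) x y.

Definition weight k : R :=
  (4 ^ d * leaf_cost k)%:R / (side k ^ d * side k ^ d)%:R.

Definition potential k (tau sigma : node d n) : R :=
  \sum_(k <= j < D) weight j * (nearby_pairs (6 * side j) tau sigma)%:R.

Lemma weight_ge0 k : 0 <= weight k.
Proof. by rewrite mulr_ge0 ?invr_ge0 ?ler0n. Qed.

Lemma potential_ge0 k tau sigma : 0 <= potential k tau sigma.
Proof. by apply: sumr_ge0 => j _; rewrite mulr_ge0 ?weight_ge0. Qed.

Lemma potential_children k t s :
  cluster_subtree t -> cluster_subtree s -> ~~ is_leaf t -> ~~ is_leaf s ->
  potential k (croot t) (croot s) =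
  \sum_i \sum_j potential k (croot (child t i)) (croot (child s j)).
Proof.
move=> sub_t sub_s nleaf_t nleaf_s; rewrite /potential.
under [RHS]eq_bigr do rewrite exchange_big /=.
rewrite [RHS]exchange_big; apply: eq_bigr => j _ /=.
rewrite nearby_pairs_children // natr_sum mulr_sumr; apply: eq_bigr => i _.
by rewrite natr_sum mulr_sumr.
Qed.

(** The nearby pairs of level k inside a branch of level k pay for its leaf
children, those of the deeper levels for its other children. *)
Lemma branch_update_cost (u : vector) t s (B : block_tree adm t s)
    (S : htlr_storage R p B) (f : vector) k :
  well_cut k t -> well_cut k s -> is_branch B ->
  (htlr_update u S f).2%:R <= potential k (croot t) (croot s).
Proof.
elim: t s / B S f k => // t s nadm_ts nleaf_ts B IHB S f k t_cut s_cut _ /=.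
move: (nleaf_ts); rewrite negb_or => /andP[nleaf_t nleaf_s].
have le_n0 := side_nonleaf t_cut nleaf_t.
have lt_kD := D_depth le_n0.
(* A uniform bound for leaf and branch children. *)
pose c (ij : 'I_(arity t) * 'I_(arity s)) : R := (leaf_cost k)%:R +
  potential k.+1 (croot (child t ij.1)) (croot (child s ij.2)).
apply: le_trans (foldl_update_cost (c := c) _ _ _) _ => [[i j] g|] /=.
  have cut_i := well_cut_child i t_cut nleaf_t.
  have cut_j := well_cut_child j s_cut nleaf_s.
  have [branch|leaf] := boolP (is_branch (B i j)).
    by rewrite (le_trans (IHB _ _ _ _ _ cut_i cut_j branch)) ?lerDr.
  apply: le_trans (_ : (leaf_cost k)%:R <= _).
    by rewrite ler_nat; apply: leaf_update_cost.
  by rewrite lerDl potential_ge0.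
rewrite add0r big_enum /= big_split /=.
have [sub_t part_t box_t] := t_cut; have [sub_s part_s box_s] := s_cut.
rewrite -(pair_bigA _ (fun i j =>
  potential k.+1 (croot (child t i)) (croot (child s j)))) /=.
rewrite -potential_children // [in leRHS]/potential big_ltn // lerD2r.
rewrite nearby_pairs_all; last exact: nearby_nadm.
apply: le_trans (_ : (4 ^ d * leaf_cost k)%:R <= _).
  rewrite sumr_const -mulrnA ler_nat mulnC leq_mul2r card_prod !card_ord.
  rewrite -[4%N]/(2 * 2)%N expnMn leq_mul ?orbT //.
    exact: arity_le part_t nleaf_t.
  exact: arity_le part_s nleaf_s.
have side_gt0 : (0 < side k)%N by apply: leq_trans le_n0.
rewrite /weight -mulrA ler_peMr ?ler0n // mulrC.
rewrite ler_pdivlMr ?ltr0n ?muln_gt0 ?expn_gt0 ?side_gt0 // mul1r ler_nat.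
have /andP[le_t _] := card_box box_t; have /andP[le_s _] := card_box box_s.
exact: leq_mul.
Qed.

End BlockCost.

(** * Summation over the levels *)

Section LevelSums.
Variables (R : realFieldType) (n n0 : nat).
Hypothesis n0_gt0 : (0 < n0)%N.
Local Notation side := (side n).

(** For 0 < n0 <= n, the number of levels k with n0 <= side n k, which are the
only ones that can contain branches. *)
Definition depth : nat := (trunc_log 2 (n %/ n0)).+1.

Lemma lt_depth k : (n0 <= side k)%N -> (k < depth)%N.
Proof.
rewrite leq_divRL ?expn_gt0 // mulnC -leq_divRL // => le_k.
by rewrite ltnS; apply: trunc_log_max.
Qed.

Lemma side_depth k : (n0 <= n)%N -> (k < depth)%N -> (n0 <= side k)%N.
Proof.
move=> le_n0 lt_k; rewrite leq_divRL ?expn_gt0 // mulnC -leq_divRL //.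
apply: leq_trans (_ : 2 ^ trunc_log 2 (n %/ n0) <= _)%N.
  by rewrite leq_exp2l.
by apply: trunc_logP; rewrite // divn_gt0.
Qed.

(** Geometric series: the side at least halves at each level, so all the
previous terms together are at most the next one. *)
Lemma sum_inv_side_lt k : (0 < side k)%N ->
  \sum_(0 <= j < k) (side j)%:R^-1 <= (side k)%:R^-1 :> R.
Proof.
elim: k => [|k IHk] side_gt0; first by rewrite big_geq // invr_ge0.
have le_side : (side k.+1 * 2 <= side k)%N by rewrite sideS leq_trunc_div.
have sidek_gt0 : (0 < side k)%N by move: side_gt0 le_side; lia.
rewrite big_nat_recr //= (le_trans (lerD (IHk sidek_gt0) (lexx _))) //.
have le_inv : (side k)%:R^-1 <= (side k.+1 * 2)%:R^-1 :> R.
  by rewrite lef_pV2 ?posrE ?ltr0n ?muln_gt0 ?side_gt0 // ler_nat.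
apply: le_trans (lerD le_inv le_inv) _.
have side_neq0 : (side k.+1)%:R != 0 :> R by rewrite pnatr_eq0 -lt0n.
by rewrite natrM le_eqVlt; apply/orP; left; apply/eqP; field.
Qed.

Lemma sum_inv_side : (n0 <= n)%N ->
  \sum_(0 <= j < depth) (side j)%:R^-1 <= 2 / n0%:R :> R.
Proof.
move=> le_n0; have := side_depth le_n0 (leqnn depth).
rewrite /depth; set k := trunc_log _ _ => le_k.
have side_gt0 : (0 < side k)%N := leq_trans n0_gt0 le_k.
rewrite big_nat_recr //= (le_trans (lerD (sum_inv_side_lt side_gt0) (lexx _))) //.
rewrite -mulr2n -[leLHS]mulr_natl ler_pM2l ?ltr0n //.
by rewrite lef_pV2 ?posrE ?ltr0n // ler_nat.
Qed.

End LevelSums.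

Section MatvecCost.
Variables (R : realFieldType) (d n n0 p : nat) (adm : node d n -> node d n -> Prop).
Hypotheses (d_gt0 : (0 < d)%N) (le_n0p : (n0 <= 2 * p)%N).
Local Notation side := (side n).

(** A root without children that is not admissible is a dense block, and then
n <= n0 <= 2 p. *)
Lemma leaf_matvec_cost t s (B : block_tree adm t s) (S : htlr_storage R p B)
    (u : {ffun grid d n -> R}) :
  well_cut n0 0 t -> well_cut n0 0 s ->
  ~ adm (croot t) (croot s) -> ~~ is_branch B ->
  (htlr_matvec S u).2%:R <= (3 * 2 ^ d)%:R * (p%:R ^+ d * (n ^ d)%:R) :> R.
Proof.
rewrite /htlr_matvec; move: [ffun _ => _] => f.
case: B S => {}t {}s => [adm_ts|nadm_ts leaf_ts|//] S t_cut s_cut // _ _.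
rewrite [X in X.2%:R]/(dense_update S u f) dense_update_cost.
have le_nn0 : (n <= n0)%N.
  have : (side 0 <= n0)%N.
    by case/orP: (leaf_ts) => [/(leaf_side d_gt0 t_cut)|/(leaf_side d_gt0 s_cut)].
  by rewrite [side 0]divn1.
have le_N (tau : node d n) : (#|points tau| <= n ^ d)%N.
  by rewrite (leq_trans (max_card _)) // card_ffun !card_ord.
rewrite -natrX -!natrM ler_nat.
have le_np : (n ^ d <= 2 ^ d * p ^ d)%N.
  by rewrite -expnMn leq_exp2r // (leq_trans le_nn0).
have := le_N (croot t); have := le_N (croot s).
move: #|points _| #|points _| (n ^ d)%N (2 ^ d)%N (p ^ d)%N le_np => a b c e g.
move=> le_c le_a le_b; apply: (@leq_trans (3 * (c * c))%N).
  have le_ab : (a * b <= c * c)%N by rewrite leq_mul.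
  have le_cc : (c <= c * c)%N by case: (c) => // c'; rewrite leq_pmulr.
  by rewrite mulnS [(a * _)%N]mulnCA; move: le_ab le_cc le_a; lia.
by rewrite -mulnA leq_mul2l mulnA leq_mul2r le_c orbT.
Qed.

Hypotheses (n0_gt0 : (0 < n0)%N) (p_gt0 : (0 < p)%N) (le_pn0 : (p <= n0)%N).

(** The bound p <= side k brings p^(2d) / side^d down to p^d (p / side), whose
sum over k is still geometric. *)
Lemma leaf_cost_le k : (n0 <= side k)%N ->
  (leaf_cost d n p k)%:R / (side k)%:R ^+ d <=
  (2 * (4 * d).+1)%:R * p%:R +
  (3 * 16 ^ d)%:R * p%:R ^+ d * (p%:R / (side k)%:R) :> R.
Proof.
move=> le_n0; have side_gt0 : (0 < side k)%N := leq_trans n0_gt0 le_n0.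
have F_gt0 : 0 < (side k)%:R ^+ d :> R by rewrite exprn_gt0 ?ltr0n.
have ratio : (p%:R / (side k)%:R) ^+ d <= p%:R / (side k)%:R :> R.
  have ratio_le1 : p%:R / (side k)%:R <= 1 :> R.
    by rewrite ler_pdivrMr ?ltr0n // mul1r ler_nat (leq_trans le_pn0).
  by rewrite -{2}[_ / _]expr1 ler_wiXn2l // divr_ge0 ?ler0n.
apply: le_trans (_ : (2 * (4 * d).+1)%:R * p%:R +
    (3 * 16 ^ d)%:R * p%:R ^+ d * (p%:R / (side k)%:R) ^+ d <= _); last first.
  by rewrite lerD2l ler_wpM2l // mulr_ge0 ?exprn_ge0 ?ler0n.
rewrite ler_pdivrMr // mulrDl expr_div_n.
have clear_F (c q : R) :
    c * q * (q / (side k)%:R ^+ d) * (side k)%:R ^+ d = c * q ^+ 2.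
  by field; rewrite gt_eqF.
rewrite clear_F.
rewrite -!natrX -!natrM -natrD ler_nat /leaf_cost.
have -> : ((4 * p) ^ d * (4 * p) ^ d = 16 ^ d * (p ^ d) ^ 2)%N.
  by rewrite -[16%N]/(4 * 4)%N !expnMn; ring.
move: (side k ^ d)%N (16 ^ d)%N ((p ^ d) ^ 2)%N => a b c; nia.
Qed.

Lemma potential_full : (n0 <= n)%N ->
  potential R p (depth n n0) 0 (@full_node d n) (@full_node d n) <=
  (48 ^ d * n ^ d)%:R * ((2 * (4 * d).+1)%:R * p%:R * (depth n n0)%:R +
     (6 * 16 ^ d)%:R * p%:R ^+ d).
Proof.
move=> le_n0.
apply: le_trans (_ : \sum_(0 <= k < depth n n0) (48 ^ d * n ^ d)%:R *
   ((2 * (4 * d).+1)%:R * p%:R +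
    (3 * 16 ^ d)%:R * p%:R ^+ d * (p%:R / (side k)%:R)) <= _).
  rewrite /potential big_nat [leRHS]big_nat; apply: ler_sum => k /andP[_ lt_k].
  have le_k := side_depth n0_gt0 le_n0 lt_k.
  have side_gt0 : (0 < side k)%N := leq_trans n0_gt0 le_k.
  have F_neq0 : (side k)%:R ^+ d != 0 :> R by rewrite expf_neq0 // pnatr_eq0 -lt0n.
  apply: le_trans (ler_wpM2l (ler0n _ _) (leaf_cost_le le_k)).
  have le_near : (nearby_pairs (6 * side k) (@full_node d n) (@full_node d n))%:R <=
      (n ^ d * (2 * (6 * side k)) ^ d)%:R :> R by rewrite ler_nat nearby_pairs_full.
  apply: le_trans (ler_wpM2l (weight_ge0 R d n p k) le_near) _.
  rewrite mulnA -[(2 * 6)%N]/12%N -[48%N]/(4 * 12)%N /weight !expnMn !natrM !natrX.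
  by rewrite le_eqVlt; apply/orP; left; apply/eqP; field.
rewrite -mulr_sumr ler_wpM2l // big_split /= sumr_const_nat subn0.
rewrite [_ * (depth n n0)%:R]mulr_natr lerD2l -!mulr_sumr.
have le_sum : p%:R * \sum_(0 <= k < depth n n0) (side k)%:R^-1 <= 2%:R :> R.
  apply: le_trans (_ : p%:R * (2 / n0%:R) <= _).
    by rewrite ler_wpM2l ?sum_inv_side.
  by rewrite mulrCA ler_piMr // ler_pdivrMr ?ltr0n // mul1r ler_nat.
apply: le_trans (ler_wpM2l _ le_sum) _; first by rewrite mulr_ge0 ?exprn_ge0.
by rewrite mulrAC -natrM mulnAC.
Qed.

Hypothesis nearby_nadm : forall k tau sigma, (n0 <= side k)%N ->
  box_at k tau -> box_at k sigma -> ~ adm tau sigma ->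
  forall x y, x \in points tau -> y \in points sigma -> nearby (6 * side k) x y.

Lemma branch_matvec_cost t s (B : block_tree adm t s) (S : htlr_storage R p B)
    (u : {ffun grid d n -> R}) :
  well_cut n0 0 t -> well_cut n0 0 s ->
  croot t = full_node -> croot s = full_node -> is_branch B ->
  (n0 < n)%N /\
  (htlr_matvec S u).2%:R <=
  (48 ^ d * n ^ d)%:R * ((2 * (4 * d).+1)%:R * p%:R * (depth n n0)%:R +
     (6 * 16 ^ d)%:R * p%:R ^+ d) :> R.
Proof.
move=> t_cut s_cut full_t full_s branch.
have nleaf_t : ~~ is_leaf t.
  move: branch; case: (B) => // ? ? _ nleaf _ _.
  by apply: contra nleaf => ->.
have lt_n0 : (n0 < n)%N.
  have [_ part_t _] := t_cut; have := nonleaf_large part_t nleaf_t.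
  move=> /leq_trans/(_ (max_card _)); rewrite card_ffun !card_ord.
  by rewrite ltn_exp2r.
split=> //; apply: le_trans (potential_full (ltnW lt_n0)).
rewrite -{1}full_t -full_s; apply: (branch_update_cost (n0 := n0)) => // k.
exact: lt_depth.
Qed.

End MatvecCost.

(** * Cubes are not null sets *)

Local Open Scope classical_set_scope.

Section CubeVolume.
Variables (R : realType) (d : nat).
Local Notation mu := (@lebesgue_measure R).

Lemma integral_box_le (c h a b : R) : 0 <= c -> a <= b ->
  (\int[mu]_(t in `[0%R, h]) (c%:E * (\1_`[a, b] t)%:E) <= (c * (b - a))%:E)%E.
Proof.
move=> c_ge0 le_ab.
rewrite ge0_integralZl_EFin //=; last first.
  exact/measurable_EFinP/measurable_indic.
rewrite integral_indic //= EFinM lee_wpmul2l ?lee_fin //.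
apply: (@le_trans _ _ (mu `[a, b])).
  by apply: le_measure => [||t []//]; rewrite inE //; apply: measurableI.
rewrite lebesgue_measure_itv /= lte_fin; case: ifP => // _.
by rewrite lee_fin subr_ge0.
Qed.

(** Integrating the inequality 1 <= \sum_k 1_(box k) over [0, h] in one
coordinate after the other: each integration multiplies the left-hand side by h
and replaces, in each term, the indicator of an edge by a bound for its
integral, the length of that edge.  This needs only Lebesgue measure on the
line and exchange of integral and series for nonnegative terms. *)
Lemma cube_volume_le (a b : nat -> 'rV[R]_d) (h : R) : 0 <= h ->
  (forall k l, a k 0 l <= b k 0 l) ->
  [set x : 'rV[R]_d | forall l, 0 <= x 0 l <= h] `<=`
    \bigcup_k [set x | forall l, a k 0 l <= x 0 l <= b k 0 l] ->
  ((h ^+ d)%:E <=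
     \sum_(0 <= k <oo) (\prod_(l < d) (b k 0 l - a k 0 l))%:E)%E.
Proof.
move=> h_ge0 le_ab cover.
(* The coordinates in ls have been integrated. *)
pose factor (ls : seq 'I_d) (x : 'rV[R]_d) k l : R :=
  if l \in ls then b k 0 l - a k 0 l else \1_`[a k 0 l, b k 0 l] (x 0 l).
have factor_ge0 ls x k l : 0 <= factor ls x k l.
  by rewrite /factor; case: ifP => // _; rewrite subr_ge0.
suff slices ls : uniq ls -> forall x : 'rV[R]_d, (forall l, 0 <= x 0 l <= h) ->
    ((h ^+ size ls)%:E <= \sum_(0 <= k <oo) (\prod_l factor ls x k l)%:E)%E.
  have := slices (enum 'I_d) (enum_uniq _) 0.
  rewrite size_enum_ord => /(_ _)/le_trans; apply=> [l|].
    by rewrite mxE lexx.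
  rewrite le_eqVlt; apply/orP; left; apply/eqP; apply: eq_eseriesr => k _.
  congr (_%:E); apply: eq_bigr => l _.
  by rewrite /factor mem_enum.
elim: ls => [|l ls IHls] /=.
  move=> _ x cube_x; have [k _ box_x] := cover x cube_x.
  rewrite expr0; apply: le_trans (_ : (\prod_l factor [::] x k l)%:E <= _)%E.
    rewrite lee_fin big1 // => l _; rewrite /factor indicE mem_set //=.
    by rewrite in_itv /= box_x.
  have term_ge0 j : (0 <= (\prod_l factor [::] x j l)%:E)%E.
    by rewrite lee_fin prodr_ge0.
  apply: le_trans (nneseries_lim_ge k.+1 (fun j _ _ => term_ge0 j)).
  by rewrite big_nat_recr //= leeDr // sume_ge0.
case/andP=> l_ls uniq_ls x cube_x.
pose slice t : 'rV[R]_d := \row_l' (if l' == l then t else x 0 l').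
pose c k := \prod_(l' | l' != l) factor ls x k l'.
have c_ge0 k : 0 <= c k by apply: prodr_ge0.
have factor_slice t k :
    \prod_l' factor ls (slice t) k l' = c k * \1_`[a k 0 l, b k 0 l] t.
  rewrite (bigD1 l) //= /factor (negPf l_ls) mxE eqxx mulrC; congr (_ * _).
  by apply: eq_bigr => l' nl'; rewrite mxE (negPf nl').
have measurable_term k : measurable_fun `[0%R, h]
    (fun t => (c k)%:E * (\1_`[a k 0 l, b k 0 l] t)%:E)%E.
  apply: measurable_funeM.
  exact/measurable_EFinP/measurable_indic.
have -> : (h ^+ (size ls).+1)%:E =
    (\int[mu]_(t in `[0%R, h]) cst (h ^+ size ls)%:E t)%E.
  rewrite integral_cst //= lebesgue_measure_itv /= lte_fin.
  have [h_gt0|] := ltP 0 h; first by rewrite -EFinD subr0 exprSr.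
  move=> h_le0; have h0 : h = 0 by lra.
  by rewrite h0 exprS mul0r mule0.
apply: le_trans (_ : \int[mu]_(t in `[0%R, h])
    \sum_(0 <= k <oo) ((c k)%:E * (\1_`[a k 0 l, b k 0 l] t)%:E) <= _)%E.
  apply: ge0_le_integral => //=.
  - by move=> t _; rewrite lee_fin exprn_ge0.
  - apply: (@ge0_emeasurable_sum _ _ _ _ _ predT).
      by move=> k t _ _; rewrite mule_ge0 // lee_fin.
    by move=> k _; apply: measurable_term.
  move=> t /= ; rewrite in_itv /= => t_h.
  have := IHls uniq_ls (slice t).
  under eq_eseriesr do rewrite factor_slice EFinM.
  by apply=> l'; rewrite mxE; case: eqP.
rewrite integral_nneseries //; last first.
  by move=> k t _; rewrite mule_ge0 // lee_fin.
apply: lee_nneseries => [k _ _|k _].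
  by apply: integral_ge0 => t _; rewrite mule_ge0 // lee_fin.
have -> : \prod_l' factor (l :: ls) x k l' = c k * (b k 0 l - a k 0 l).
  rewrite (bigD1 l) //= /factor mem_head mulrC; congr (_ * _).
  by apply: eq_bigr => l' nl'; rewrite in_cons (negPf nl').
exact: integral_box_le.
Qed.

End CubeVolume.

(** * Admissibility of distant nodes and of the root *)

Section Euclid.
Variables (R : realType) (d : nat).
Implicit Types (x y : 'rV[R]_d) (E F : set 'rV[R]_d) (c : R).

Lemma euclid_le x y c : 0 <= c -> (forall l, `|x 0 l - y 0 l| <= c) ->
  euclid x y <= Num.sqrt d%:R * c.
Proof.
move=> c_ge0 le_c; rewrite /euclid -[in leRHS](ger0_norm c_ge0) -sqrtr_sqr -sqrtrM //.
rewrite ler_sqrt ?mulr_ge0 ?sqr_ge0 // mulr_natl -[X in _ *+ X](card_ord d).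
rewrite -sumr_const; apply: ler_sum => l _.
by rewrite -real_normK ?num_real // lerXn2r ?nnegrE.
Qed.

Lemma coord_le_euclid x y l : `|x 0 l - y 0 l| <= euclid x y.
Proof.
rewrite /euclid -sqrtr_sqr ler_sqrt ?sumr_ge0 // => [|? _]; last exact: sqr_ge0.
by rewrite (bigD1 l) //= lerDl sumr_ge0 // => ? _; apply: sqr_ge0.
Qed.

Lemma diam_le E c : E !=set0 -> (forall x y, E x -> E y -> euclid x y <= c) ->
  diam E <= c.
Proof.
move=> [x Ex] le_c; apply: ge_sup; first by exists (euclid x x), (x, x).
by move=> _ [[y z] [Ey Ez] <-]; apply: le_c.
Qed.

Lemma dist_ge E F c : E !=set0 -> F !=set0 ->
  (forall x y, E x -> F y -> c <= euclid x y) -> c <= Defs.dist E F.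
Proof.
move=> [x Ex] [y Fy] ge_c; apply: lb_le_inf; first by exists (euclid x y), (x, y).
by move=> _ [[z t] [Ez Ft] <-]; apply: ge_c.
Qed.

End Euclid.

Section Admissible.
Variables (R : realType) (d n : nat).
Hypothesis n_gt0 : (0 < n)%N.
Implicit Types tau sigma : node d n.

Lemma domainP tau (x : 'rV[R]_d) : domain tau x ->
  exists2 i : grid d n, i \in points tau &
    forall l, (i l)%:R / n%:R <= x 0 l <= (i l).+1%:R / n%:R.
Proof. by case=> i; exists i. Qed.

Lemma domain_nonempty tau : points tau != finset.set0 -> domain (R := R) tau !=set0.
Proof.
case/set0Pn => i tau_i; exists (\row_l ((i l)%:R / n%:R)), i => // l.
by rewrite mxE lexx ler_wpM2r ?invr_ge0 // ler_nat.
Qed.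

Section FarBoxes.
Variables (k : nat) (tau sigma : node d n).
Hypotheses (side_gt0 : (0 < side n k)%N).
Hypotheses (box_tau : box_at k tau) (box_sigma : box_at k sigma).

Lemma domain_diam_le : points tau != finset.set0 ->
  diam (domain (R := R) tau) <= Num.sqrt d%:R * ((2 * side n k)%:R / n%:R).
Proof.
move=> tau_n0; apply: diam_le; first exact: domain_nonempty.
move=> x y /domainP[i tau_i x_i] /domainP[j tau_j y_j].
apply: euclid_le => [|l]; first by rewrite divr_ge0.
have [conv_l card_l] := box_tau l.
move: tau_i tau_j; rewrite !mem_points => /forallP/(_ l) tau_i /forallP/(_ l) tau_j.
have := convex_spread conv_l tau_i tau_j; have := convex_spread conv_l tau_j tau_i.
have /andP[ge_x le_x] := x_i l; have /andP[ge_y le_y] := y_j l.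
move=> lt_ij lt_ji.
have le_ij : ((i l).+1 <= j l + 2 * side n k)%N by move: side_gt0; lia.
have le_ji : ((j l).+1 <= i l + 2 * side n k)%N by move: side_gt0; lia.
have n_inv : 0 <= (n%:R : R)^-1 by rewrite invr_ge0.
have := ler_wpM2r n_inv (_ : (i l).+1%:R <= (j l + 2 * side n k)%:R).
have := ler_wpM2r n_inv (_ : (j l).+1%:R <= (i l + 2 * side n k)%:R).
rewrite !ler_nat => /(_ le_ji) + /(_ le_ij); rewrite !natrD !mulrDl ler_norml.
by move=> *; apply/andP; split; lra.
Qed.

Hypotheses (x y : grid d n) (tau_x : x \in points tau) (sigma_y : y \in points sigma).
Variable l : 'I_d.

(** Moving from x to another point of tau, or from y to another point of sigma,
changes coordinate l by less than 2 side; of the gap 6 side there remain more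
than 2 side, also after the width of one cell. *)
Lemma far_coord u v : (y l + 6 * side n k <= x l)%N ->
  domain tau u -> domain sigma v -> (2 * side n k)%:R / n%:R <= u 0 l - v 0 l :> R.
Proof.
move=> far /domainP[i tau_i u_i] /domainP[j sigma_j v_j].
have [conv_t /andP[_ card_t]] := box_tau l.
have [conv_s /andP[_ card_s]] := box_sigma l.
move: tau_x sigma_y tau_i sigma_j; rewrite !mem_points.
move=> /forallP/(_ l) tau_xl /forallP/(_ l) sigma_yl.
move=> /forallP/(_ l) tau_i /forallP/(_ l) sigma_j.
have := convex_spread conv_t tau_i tau_xl.
have := convex_spread conv_s sigma_yl sigma_j => lt_j lt_x.
have le_ji : ((j l).+1 + 2 * side n k <= i l)%N by move: side_gt0; lia.
have /andP[ge_u _] := u_i l; have /andP[_ le_v] := v_j l.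
have n_inv : 0 <= (n%:R : R)^-1 by rewrite invr_ge0.
have := ler_wpM2r n_inv (_ : ((j l).+1 + 2 * side n k)%:R <= (i l)%:R).
by rewrite ler_nat => /(_ le_ji); rewrite natrD mulrDl; lra.
Qed.

End FarBoxes.

Lemma not_nearby_apart k tau sigma x y : (0 < side n k)%N ->
  box_at k tau -> box_at k sigma -> x \in points tau -> y \in points sigma ->
  ~~ nearby (6 * side n k) x y ->
  exists l, forall u v : 'rV[R]_d, domain tau u -> domain sigma v ->
    (2 * side n k)%:R / n%:R <= `|u 0 l - v 0 l|.
Proof.
move=> side_gt0 box_t box_s tau_x sigma_y /forallPn[l far_l]; exists l => u v tau_u sigma_v.
move: far_l; rewrite negb_and -!leqNgt => /orP[] far.
  apply: le_trans (ler_norm _).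
  exact: (far_coord side_gt0 box_t box_s tau_x sigma_y far).
rewrite distrC; apply: le_trans (ler_norm _).
exact: (far_coord side_gt0 box_s box_t sigma_y tau_x far).
Qed.

Lemma far_strongly_admissible k tau sigma x y : (0 < side n k)%N ->
  box_at k tau -> box_at k sigma -> x \in points tau -> y \in points sigma ->
  ~~ nearby (6 * side n k) x y -> strongly_admissible (Num.sqrt d%:R : R) tau sigma.
Proof.
move=> side_gt0 box_t box_s tau_x sigma_y far.
have [l apart] := not_nearby_apart side_gt0 box_t box_s tau_x sigma_y far.
have tau_n0 : points tau != finset.set0 by apply/set0Pn; exists x.
have sigma_n0 : points sigma != finset.set0 by apply/set0Pn; exists y.
apply: le_trans (_ : Num.sqrt d%:R * ((2 * side n k)%:R / n%:R) <= _).
  rewrite ge_max domain_diam_le //=; exact: domain_diam_le.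
rewrite ler_wpM2l ?sqrtr_ge0 //; apply: dist_ge.
- exact: domain_nonempty.
- exact: domain_nonempty.
by move=> u v tau_u sigma_v; apply: le_trans (coord_le_euclid u v l); apply: apart.
Qed.

Hypothesis d_gt0 : (0 < d)%N.

Lemma measure_zero_set0 : measure_zero (set0 : set 'rV[R]_d).
Proof.
move=> e e_gt0; exists (fun=> 0), (fun=> 0); split=> //.
rewrite eseries0 ?lee_fin ?ltW // => k _ _.
by rewrite (bigD1 (Ordinal d_gt0)) //= subrr mul0r.
Qed.

Lemma far_weakly_admissible k tau sigma x y : (0 < side n k)%N ->
  box_at k tau -> box_at k sigma -> x \in points tau -> y \in points sigma ->
  ~~ nearby (6 * side n k) x y -> weakly_admissible R tau sigma.
Proof.
move=> side_gt0 box_t box_s tau_x sigma_y far.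
have [l apart] := not_nearby_apart side_gt0 box_t box_s tau_x sigma_y far.
rewrite /weakly_admissible (_ : _ `&` _ = set0); first exact: measure_zero_set0.
rewrite -subset0 => u [tau_u sigma_u]; have := apart u u tau_u sigma_u.
by rewrite subrr normr0 leNgt divr_gt0 // ltr0n // muln_gt0.
Qed.

(** The cell at the origin suffices to see that the root is too large to be
admissible. *)
Lemma corner_cube (u : 'rV[R]_d) :
  (forall l, 0 <= u 0 l <= n%:R^-1) -> domain (@full_node d n) u.
Proof.
move=> u_h; exists [ffun=> Ordinal n_gt0] => [|l] /=.
  by rewrite mem_points; apply/forallP => l; rewrite !ffunE inE.
by rewrite ffunE /= mul0r mul1r.
Qed.

Lemma full_not_weakly_admissible : ~ weakly_admissible R (@full_node d n) full_node.
Proof.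
rewrite /weakly_admissible setIid => null.
pose v : R := n%:R^-1 ^+ d.
have v_gt0 : 0 < v by rewrite exprn_gt0 // invr_gt0 ltr0n.
have [a [b [le_ab cover le_v]]] := null (v / 2) (divr_gt0 v_gt0 (ltr0Sn _ 1)).
have h_ge0 : 0 <= n%:R^-1 :> R by rewrite invr_ge0.
have := cube_volume_le h_ge0 le_ab (subset_trans corner_cube cover).
by move=> /le_trans/(_ le_v); rewrite lee_fin -/v; lra.
Qed.

Lemma full_not_strongly_admissible :
  ~ strongly_admissible (Num.sqrt d%:R : R) (@full_node d n) full_node.
Proof.
rewrite /strongly_admissible maxxx => le_diam.
have h_gt0 : 0 < n%:R^-1 :> R by rewrite invr_gt0 ltr0n.
pose u : 'rV[R]_d := 0; pose v : 'rV[R]_d := const_mx n%:R^-1.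
have full_u : domain (@full_node d n) u by apply: corner_cube => l; rewrite mxE lexx ltW.
have full_v : domain (@full_node d n) v by apply: corner_cube => l; rewrite mxE lexx ltW.
have : Defs.dist (domain (@full_node d n)) (domain (@full_node d n)) <= 0 :> R.
  apply: ge_inf.
    by exists 0 => _ [[x y] _ <-]; apply: sqrtr_ge0.
  exists (u, u) => //=; rewrite /euclid big1 ?sqrtr0 // => l _.
  by rewrite subrr expr0n.
move/(ler_wpM2l (sqrtr_ge0 d%:R)); rewrite mulr0 => /(le_trans le_diam).
apply/negP; rewrite -ltNge; apply: (@lt_le_trans _ _ (euclid u v)).
  apply: lt_le_trans (coord_le_euclid u v (Ordinal d_gt0)).
  by rewrite !mxE sub0r normrN gtr0_norm.
apply: ub_le_sup; last by exists (u, v).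
exists (Num.sqrt d%:R) => _ [[x y] [/= /domainP[i _ x_i] /domainP[j _ y_j]] <-].
rewrite -[leRHS]mulr1; apply: euclid_le => // l.
have le1 (q : 'I_n) : q.+1%:R / n%:R <= 1 :> R.
  by rewrite ler_pdivrMr ?ltr0n // mul1r ler_nat.
have ge0 (q : 'I_n) : 0 <= q%:R / n%:R :> R by rewrite divr_ge0.
have /andP[ge_x le_x] := x_i l; have /andP[ge_y le_y] := y_j l.
have := le1 (i l); have := le1 (j l); have := ge0 (i l); have := ge0 (j l).
by rewrite ler_norml => *; apply/andP; split; lra.
Qed.

End Admissible.

(** * The complexity bound *)

(** Since n0 < n forces n >= 2, the term 1 in depth <= log2 n + 1 is absorbed in
2 log2 n. *)
Lemma depth_le_ln (R : realType) (d n n0 : nat) : (0 < d)%N -> (0 < n0 < n)%N ->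
  (depth n n0)%:R <= 2 / ln 2 * ln (n ^ d)%:R :> R.
Proof.
move=> d_gt0 /andP[n0_gt0 lt_n0]; have n_gt1 : (1 < n)%N := leq_ltn_trans n0_gt0 lt_n0.
have ln2_gt0 : 0 < ln 2 :> R by rewrite ln_gt0 // ltr1n.
have n_gt0 : (0 < n)%N := ltnW n_gt1.
set k := trunc_log 2 n.
have k_gt0 : (0 < k)%N by rewrite trunc_log_max.
have le_depth : (depth n n0 <= 2 * k)%N.
  apply: (@leq_trans k.+1); last lia.
  by rewrite ltnS leq_trunc_log // leq_div.
apply: le_trans (_ : (2 * k)%:R <= _); first by rewrite ler_nat.
rewrite natrM -mulrA ler_wpM2l // mulrC ler_pdivlMr //.
rewrite [leLHS]mulr_natl -lnXn ?ltr0n // -natrX.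
rewrite ler_ln ?posrE ?ltr0n ?expn_gt0 ?n_gt0 // ler_nat.
apply: leq_trans (trunc_logP _ n_gt0) _ => //.
by rewrite -{1}[n]expn1 leq_exp2l.
Qed.

Theorem proposition4p1 (R : realType) (d : nat) (hd : (2 <= d)%N) :
  exists C : R,
  forall n n0 p : nat, (0 < n)%N -> (0 < n0)%N -> (0 < p)%N ->
  (p <= n0 <= 2 * p)%N ->
  forall T : ctree d n,
  tensor_cluster_tree T -> uniform_partition (n0 ^ d) T ->
  forall adm : node d n -> node d n -> Prop,
  adm = @weakly_admissible R d n \/
  adm = @strongly_admissible R d n (Num.sqrt d%:R) ->
  forall (B : block_tree adm T T) (S : htlr_storage R p B)
         (A : grid d n -> grid d n -> R),
  represents A S ->
  forall u : {ffun grid d n -> R},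
  let N := (n ^ d)%N in
  let result := htlr_matvec S u in
  result.1 = [ffun x => \sum_y A x y * u y] /\
  result.2%:R <= C * (p%:R * N%:R * ln N%:R + p%:R ^+ d * N%:R).
Proof.
have d_gt0 : (0 < d)%N by apply: leq_trans hd.
pose c1 : R := (2 * (4 * d).+1)%:R * (2 / ln 2).
pose c2 : R := (6 * 16 ^ d)%:R.
(* The first summand is for a root that is split, the second for a dense root. *)
exists ((48 ^ d)%:R * (c1 + c2) + (3 * 2 ^ d)%:R).
move=> n n0 p n_gt0 n0_gt0 p_gt0 /andP[le_pn0 le_n0p] T [root_T sub_T] part_T.
move=> adm admE B S A repA u N result.
split.
  rewrite /result /htlr_matvec (htlr_updateE u _ sub_T sub_T repA) root_T.
  have all_in x : x \in points (@full_node d n).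
    by rewrite mem_points; apply/forallP => l; rewrite !ffunE inE.
  apply/ffunP => x; rewrite !ffunE add0r all_in.
  by apply: eq_bigl => y; rewrite all_in.
have N_gt0 : (0 < N)%N by rewrite expn_gt0 n_gt0.
have ln2_gt0 : 0 < ln 2 :> R by rewrite ln_gt0 // ltr1n.
have lnN_ge0 : 0 <= ln N%:R :> R by rewrite ln_ge0 // ler1n.
have T_cut : well_cut n0 0 T by split=> //; rewrite root_T; apply: box_at_full.
have full_nadm : ~ adm (croot T) (croot T).
  rewrite root_T; case: admE => ->; first exact: full_not_weakly_admissible.
  exact: full_not_strongly_admissible.
have nearby_nadm k tau sigma : (n0 <= side n k)%N ->
    box_at k tau -> box_at k sigma -> ~ adm tau sigma ->
    forall x y, x \in points tau -> y \in points sigma ->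
    nearby (6 * side n k) x y.
  move=> le_k box_t box_s nadm x y tau_x sigma_y.
  have side_gt0 := leq_trans n0_gt0 le_k.
  apply/negPn/negP => far; apply: nadm; case: admE => ->.
    exact: (far_weakly_admissible n_gt0 d_gt0 side_gt0 box_t box_s tau_x sigma_y far).
  exact: (far_strongly_admissible R n_gt0 side_gt0 box_t box_s tau_x sigma_y far).
have c1_ge0 : 0 <= c1 by rewrite mulr_ge0 ?divr_ge0 // ltW.
have c2_ge0 : 0 <= c2 by [].
have X_ge0 : 0 <= p%:R * N%:R * ln N%:R :> R by rewrite !mulr_ge0.
have Y_ge0 : 0 <= p%:R ^+ d * N%:R :> R by rewrite mulr_ge0 ?exprn_ge0.
have K_ge0 : 0 <= (48 ^ d)%:R :> R by [].
have K'_ge0 : 0 <= (3 * 2 ^ d)%:R :> R by [].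
have [branch|leaf] := boolP (is_branch B); last first.
  apply: le_trans (leaf_matvec_cost d_gt0 le_n0p S u T_cut T_cut full_nadm leaf) _.
  rewrite mulrDl ler_wpDl ?mulr_ge0 ?addr_ge0 //.
  by rewrite ler_wpM2l // lerDr.
have [lt_n0 le_cost] := branch_matvec_cost d_gt0 le_n0p n0_gt0 p_gt0 le_pn0
  nearby_nadm S u T_cut T_cut root_T root_T branch.
have := depth_le_ln R d_gt0 (introT andP (conj n0_gt0 lt_n0)); rewrite -/N => le_depth.
apply: (le_trans le_cost); rewrite mulrDl.
apply: le_trans (_ : (48 ^ d)%:R * (c1 * (p%:R * N%:R * ln N%:R) +
    c2 * (p%:R ^+ d * N%:R)) <= _).
  rewrite natrM -mulrA ler_wpM2l // mulrDr [c2 * _]mulrA [N%:R * (c2 * _)]mulrC.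
  rewrite lerD2r; apply: le_trans (ler_wpM2l _ (ler_wpM2l _ le_depth)) _ => //.
  by rewrite /c1 le_eqVlt; apply/orP; left; apply/eqP; ring.
apply: ler_wpDr; first by rewrite mulr_ge0 ?addr_ge0.
rewrite -[leRHS]mulrA ler_wpM2l // [leRHS]mulrDl.
by rewrite lerD // ler_wpM2l // ?lerDl ?lerDr.
Qed.
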